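(* The class $\mathscr{E}$ of elementary groups enjoys the following permanence properties: (1) $\mathscr{E}$ is closed under group extension: if $G$ is a t.d.l.c.s.c. group and $H\trianglelefteq G$ is a closed normal subgroup such that $H, G/H\in\mathscr{E}$, then $G\in\mathscr{E}$. (2) If $G\in\mathscr{E}$, $H$ is a t.d.l.c.s.c. group, and $\psi:H\to G$ is a continuous, injective homomorphism, then $H\in\mathscr{E}$. In particular, $\mathscr{E}$ is closed under taking closed subgroups. (3) $\mathscr{E}$ is closed under taking quotients by closed normal subgroups. (4) If $G$ is a residually elementary t.d.l.c.s.c. group, then $G\in\mathscr{E}$. In particular, $\mathscr{E}$ is closed under inverse limits that result in a t.d.l.c.s.c. group. (5) $\mathscr{E}$ is closed under quasi-products: if a t.d.l.c.s.c. group $G$ is a quasi-product with quasi-factors $N_1,\dots,N_k$ and $N_i\in\mathscr{E}$ for each $i$, then $G\in\mathscr{E}$. (6) $\mathscr{E}$ is closed under local direct products: if $(G_a)_{a\in A}$ is a countable family of elementary groups with a distinguished compact open subgroup $U_a\leqslant G_a$ for each $a\in A$, then the local direct product $\bigoplus_{a\in A}(G_a,U_a)$ is in $\mathscr{E}$. (7) If $G$ is a t.d.l.c.s.c. group and $(C_i)_{i\in\mathbb{N}}$ is an $\subseteq$-increasing sequence of elementary closed subgroups of $G$ such that the normalizer $N_G(C_i)$ is open for each $i$ and $\overline{\bigcup_{i\in\mathbb{N}}C_i}=G$, then $G\in\mathscr{E}$.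
   Context: A t.d.l.c.s.c. group is a totally disconnected locally compact second countable (Hausdorff) topological group. The class $\mathscr{E}$ of elementary groups is the smallest class of t.d.l.c.s.c. groups such that: (i) $\mathscr{E}$ contains all second countable profinite groups and all countable discrete groups; (ii) if $G$ is a t.d.l.c.s.c. group and $H\trianglelefteq G$ is a closed normal subgroup with $H\in\mathscr{E}$ and $G/H$ either profinite or discrete, then $G\in\mathscr{E}$; (iii) if $G$ is a t.d.l.c.s.c. group and $G=\bigcup_{i\in\mathbb{N}}O_i$ where $(O_i)_{i\in\mathbb{N}}$ is an $\subseteq$-increasing sequence of open subgroups of $G$ with $O_i\in\mathscr{E}$ for each $i$, then $G\in\mathscr{E}$. A topological group $G$ is residually elementary if for every $g\in G\setminus\{1\}$ there is a closed normal subgroup $N\trianglelefteq G$ such that $G/N\in\mathscr{E}$ and $g\notin N$. A group $G$ is a quasi-product with quasi-factors $N_1,\dots,N_k$ if each $N_i$ is a closed normal subgroup of $G$ and the multiplication map $N_1\times\dots\times N_k\to G$ is injective with dense image. Local direct product: given a countable set $A$, t.d.l.c.s.c. groups $(G_a)_{a\in A}$ and compact open subgroups $U_a\leqslant G_a$, $\bigoplus_{a\in A}(G_a,U_a)$ is the group of functions $f:A\to\bigsqcup_{a\in A}G_a$ with $f(a)\in G_a$ for all $a$ and $f(a)\in U_a$ for all but finitely many $a$, with pointwise multiplication and the group topology in which $\prod_{a\in A}U_a$ (with the product topology) is an open subgroup. It is a t.d.l.c.s.c. group. *)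

(* Defs.v *)
From HB Require Import structures.
From mathcomp Require Import all_boot all_order.
From mathcomp Require Import generic_quotient.
From mathcomp Require Import all_classical.
From mathcomp Require Import reals topology function_spaces.

Set Implicit Arguments.
Unset Strict Implicit.
Unset Printing Implicit Defensive.

Local Open Scope classical_set_scope.
Local Open Scope group_scope.

HB.mixin Record isTopologicalGroup G & Topological G & Group G := {
  mulg_continuous : continuous (fun x : G * G => x.1 * x.2) ;
  invg_continuous : continuous (fun x : G => x^-1) ;
}.

#[short(type="topologicalGroupType")]
HB.structure Definition TopologicalGroup :=
  {G of Topological G & Group G & isTopologicalGroup G}.

Definition discrete_group (G : topologicalGroupType) : Prop :=
  forall A : set G, open A.

Definition profinite (G : topologicalGroupType) : Prop :=
  [/\ compact [set: G], hausdorff_space G & totally_disconnected [set: G]].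

Definition tdlcsc (G : topologicalGroupType) : Prop :=
  [/\ totally_disconnected [set: G], locally_compact [set: G],
      @second_countable G & hausdorff_space G].

Record subgroup (G : groupType) := Subgroup {
  subgroup_set :> set G ;
  subgroup1 : subgroup_set 1 ;
  subgroupM : forall x y, subgroup_set x -> subgroup_set y ->
    subgroup_set (x * y) ;
  subgroupV : forall x, subgroup_set x -> subgroup_set x^-1 }.

(* [x ^ g] is the conjugate [g^-1 * (x * g)]. *)
Record normal_subgroup (G : groupType) := NormalSubgroup {
  normal_subgroup_val :> subgroup G ;
  normal_subgroupJ : forall x g,
    subgroup_set normal_subgroup_val x ->
    subgroup_set normal_subgroup_val (x ^ g) }.

Record compact_open_subgroup (G : topologicalGroupType) :=
  CompactOpenSubgroup {
  compact_open_subgroup_val :> subgroup G ;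
  compact_open_subgroup_compact : compact compact_open_subgroup_val ;
  compact_open_subgroup_open : open compact_open_subgroup_val }.

Definition normalizer (G : groupType) (H : subgroup G) : set G :=
  [set g | [set x ^ g | x in H] = H].

Section theory.
Variable G : topologicalGroupType.

Lemma nbhs_mulg (x y : G) (V : set G) : nbhs (x * y) V ->
  exists A B, [/\ nbhs x A, nbhs y B & forall a b, A a -> B b -> V (a * b)].
Proof.
move=> /(mulg_continuous (x, y))[[A B]] /= [nA nB] AB.
by exists A, B; split=> // a b Aa Bb; exact: (AB (a, b)).
Qed.

Lemma mulg_continuous_l (g : G) : continuous (fun x : G => g * x).
Proof.
move=> x V /nbhs_mulg[A [B [nA nB AB]]].
by apply: filterS nB => b Bb; apply: AB => //; exact: nbhs_singleton.
Qed.

Lemma mulg_continuous_r (g : G) : continuous (fun x : G => x * g).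
Proof.
move=> x V /nbhs_mulg[A [B [nA nB AB]]].
by apply: filterS nA => b Bb; apply: AB => //; exact: nbhs_singleton.
Qed.

Lemma conjg_continuous (g : G) : continuous (fun x : G => x ^ g).
Proof.
move=> x; apply: (@continuous_comp _ _ _ (fun x : G => x * g)
  (fun x => g^-1 * x)); [exact: mulg_continuous_r|exact: mulg_continuous_l].
Qed.
End theory.

Definition subgroup_group (G : topologicalGroupType) (H : subgroup G) : Type :=
  set_type H.

Section subgroup_group.
Variables (G : topologicalGroupType) (H : subgroup G).
Local Notation S := (subgroup_group H).

Lemma subgroup_closed : group_closed (fun x : G => x \in (H : set G)).
Proof.
split; first exact/mem_set/subgroup1.
move=> x y /set_mem Hx /set_mem Hy; apply/mem_set/subgroupM => //.
exact: subgroupV.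
Qed.

HB.instance Definition _ := Topological.copy S (set_type H).
HB.instance Definition _ := SubChoice.copy S (set_type H).
HB.instance Definition _ :=
  @SubChoice_isSubGroup.Build G (fun x => x \in (H : set G)) S subgroup_closed.

Lemma subgroup_val_continuous : continuous (val : S -> G).
Proof. exact: initial_continuous. Qed.

Lemma nbhs_subgroupP (x : S) (V : set S) :
  nbhs x V <-> exists2 W, nbhs (val x) W & val @^-1` W `<=` V.
Proof.
split; last first.
  by case=> W nW WV; apply: filterS WV _; exact: subgroup_val_continuous.
case=> _ [[W oW <-] Wx WV]; exists W => //; exact: open_nbhs_nbhs.
Qed.

Lemma subgroup_mulg_continuous : continuous (fun x : S * S => x.1 * x.2).
Proof.
move=> [x y] V /nbhs_subgroupP[W];
rewrite valM => /nbhs_mulg.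
move=> [A [B [nA nB AB]]] WV.
exists (val @^-1` A, val @^-1` B) => /=.
  by split; apply/subgroup_val_continuous.
by move=> [a b] [Aa Bb]; apply: WV; rewrite -[_ _]/(W (val (a * b))) valM; exact: AB.
Qed.

Lemma subgroup_invg_continuous : continuous (fun x : S => x^-1).
Proof.
move=> x V /nbhs_subgroupP[W]; rewrite [val _]gmulfV => /invg_continuous nW WV.
apply/nbhs_subgroupP; exists ((fun y => y^-1) @^-1` W) => // y /= Wy.
by apply: WV; rewrite -[_ _]/(W (val y^-1)) [val _]gmulfV.
Qed.

HB.instance Definition _ := isTopologicalGroup.Build S
  subgroup_mulg_continuous subgroup_invg_continuous.
End subgroup_group.

Section quotient_group.
Variables (G : topologicalGroupType) (N : normal_subgroup G).

Definition coset_rel : rel G := fun x y => x^-1 * y \in (N : set G).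

Lemma coset_rel_refl : reflexive coset_rel.
Proof. by move=> x; rewrite /coset_rel mulVg; exact/mem_set/subgroup1. Qed.

Lemma coset_rel_sym : symmetric coset_rel.
Proof.
suff h x y : coset_rel x y -> coset_rel y x by move=> x y; apply/idP/idP; exact: h.
move=> /set_mem/subgroupV Nxy; apply/mem_set.
by rewrite invgM invgK in Nxy.
Qed.

Lemma coset_rel_trans : transitive coset_rel.
Proof.
move=> y x z /set_mem Nxy /set_mem Nyz; apply/mem_set.
by have := subgroupM Nxy Nyz; rewrite mulgA -(mulgA x^-1) mulgV mulg1.
Qed.

Canonical coset_rel_equiv :=
  EquivRel coset_rel coset_rel_refl coset_rel_sym coset_rel_trans.

Definition quotient_group : Type :=
  quotient_topology {eq_quot coset_rel_equiv}%qT.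

Local Notation Q := quotient_group.

HB.instance Definition _ := Topological.on Q.
HB.instance Definition _ := Quotient.on Q.

Definition quotient_map : G -> Q := \pi_Q%qT.

Lemma quotient_mapP (x y : G) :
  quotient_map x = quotient_map y <-> (N : set G) (x^-1 * y).
Proof.
by split=> [/eqmodP/set_mem//|Nxy]; apply/eqmodP/mem_set.
Qed.

Lemma quotient_map_surj (q : Q) : exists x, quotient_map x = q.
Proof. by exists (repr q); exact: reprK. Qed.

Definition quotient_one : Q := quotient_map 1.
Definition quotient_mul (p q : Q) : Q := quotient_map (repr p * repr q).
Definition quotient_inv (p : Q) : Q := quotient_map (repr p)^-1.

Lemma quotient_mapM (x y : G) :
  quotient_mul (quotient_map x) (quotient_map y) = quotient_map (x * y).
Proof.
have /quotient_mapP Nx : quotient_map (repr (quotient_map x)) = quotient_map x.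
  exact: reprK.
have /quotient_mapP Ny : quotient_map (repr (quotient_map y)) = quotient_map y.
  exact: reprK.
apply/quotient_mapP; set x' := repr _ in Nx *; set y' := repr _ in Ny *.
suff -> : (x' * y')^-1 * (x * y) = ((x'^-1 * x) ^ y') * (y'^-1 * y).
  by apply: subgroupM => //; exact: normal_subgroupJ.
by rewrite invgM /conjg !mulgA mulgK.
Qed.

Lemma quotient_mapV (x : G) :
  quotient_inv (quotient_map x) = quotient_map x^-1.
Proof.
have /quotient_mapP Nx : quotient_map (repr (quotient_map x)) = quotient_map x.
  exact: reprK.
apply/quotient_mapP; set x' := repr _ in Nx *.
have := normal_subgroupJ x'^-1 (subgroupV Nx).
by rewrite /conjg invgM !invgK -mulgA mulgV mulg1.
Qed.

Fact quotient_mulgA : associative quotient_mul.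
Proof.
move=> p q r; have [x <-] := quotient_map_surj p.
have [y <-] := quotient_map_surj q; have [z <-] := quotient_map_surj r.
by rewrite !quotient_mapM mulgA.
Qed.

Fact quotient_mul1g : left_id quotient_one quotient_mul.
Proof.
by move=> p; have [x <-] := quotient_map_surj p; rewrite quotient_mapM mul1g.
Qed.

Fact quotient_mulg1 : right_id quotient_one quotient_mul.
Proof.
by move=> p; have [x <-] := quotient_map_surj p; rewrite quotient_mapM mulg1.
Qed.

Fact quotient_mulVg : left_inverse quotient_one quotient_inv quotient_mul.
Proof.
move=> p; have [x <-] := quotient_map_surj p.
by rewrite quotient_mapV quotient_mapM mulVg.
Qed.

Fact quotient_mulgV : right_inverse quotient_one quotient_inv quotient_mul.
Proof.
move=> p; have [x <-] := quotient_map_surj p.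
by rewrite quotient_mapV quotient_mapM mulgV.
Qed.

HB.instance Definition _ := isGroup.Build Q
  quotient_mulgA quotient_mul1g quotient_mulg1 quotient_mulVg quotient_mulgV.

Fact quotient_map_multiplicative : {morph quotient_map : x y / x * y}.
Proof. by move=> x y; rewrite -quotient_mapM. Qed.
HB.instance Definition _ :=
  isMultiplicative.Build G Q quotient_map quotient_map_multiplicative.

Lemma quotient_map_continuous : continuous quotient_map.
Proof. exact: pi_continuous. Qed.

Lemma quotient_map_open (A : set G) : open A -> open (quotient_map @` A).
Proof.
move=> oA.
suff -> : open (quotient_map @` A) = open (quotient_map @^-1` (quotient_map @` A)).
  have -> : quotient_map @^-1` (quotient_map @` A) =
      \bigcup_(n in (N : set G)) ((fun x => x * n) @^-1` A).
    apply/seteqP; split=> [x [a Aa /esym/quotient_mapP Nxa]|x [n Nn] /= Axn].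
      by exists (x^-1 * a) => //=; rewrite mulVKg.
    by exists (x * n) => //; apply/esym/quotient_mapP; rewrite mulKg.
  apply: bigcup_open => n _; apply: open_comp => // x _.
  exact: mulg_continuous_r.
by [].
Qed.

Lemma nbhs_quotient_map (x : G) (A : set G) :
  nbhs x A -> nbhs (quotient_map x) (quotient_map @` A).
Proof.
rewrite nbhsE => -[B [oB Bx] BA].
rewrite nbhsE; exists (quotient_map @` B); last exact: image_subset.
by split; [exact: quotient_map_open|exists x].
Qed.

Lemma quotient_mulg_continuous : continuous (fun x : Q * Q => x.1 * x.2).
Proof.
move=> [p q] V /=; have [x <-] := quotient_map_surj p.
have [y <-] := quotient_map_surj q.
rewrite -quotient_map_multiplicative => /quotient_map_continuous/nbhs_mulg.
move=> [A [B [nA nB AB]]]; exists (quotient_map @` A, quotient_map @` B) => /=.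
  by split; exact: nbhs_quotient_map.
move=> _ [/= [a Aa <-] [b Bb <-]].
by rewrite -quotient_map_multiplicative; exact: AB.
Qed.

Lemma quotient_invg_continuous : continuous (fun x : Q => x^-1).
Proof.
move=> p V /=; have [x <-] := quotient_map_surj p.
rewrite [_^-1]quotient_mapV => /quotient_map_continuous/invg_continuous.
move=> /nbhs_quotient_map; apply: filterS => _ [a Va <-].
by rewrite -[_ _]/(V (quotient_map a)^-1) [_^-1]quotient_mapV.
Qed.

HB.instance Definition _ := isTopologicalGroup.Build Q
  quotient_mulg_continuous quotient_invg_continuous.
End quotient_group.

Definition prod_group (A : Type) (G_ : A -> topologicalGroupType) : Type :=
  prod_topology G_.

Section prod_group.
Variables (A : Type) (G_ : A -> topologicalGroupType).
Local Notation P := (prod_group G_).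

HB.instance Definition _ := Topological.copy P (prod_topology G_).

Definition prod_one : P := fun a => 1.
Definition prod_mul (f g : P) : P := fun a => f a * g a.
Definition prod_inv (f : P) : P := fun a => (f a)^-1.

Fact prod_mulgA : associative prod_mul.
Proof. by move=> f g h; apply: functional_extensionality_dep => a; exact: mulgA. Qed.
Fact prod_mul1g : left_id prod_one prod_mul.
Proof. by move=> f; apply: functional_extensionality_dep => a; exact: mul1g. Qed.
Fact prod_mulg1 : right_id prod_one prod_mul.
Proof. by move=> f; apply: functional_extensionality_dep => a; exact: mulg1. Qed.
Fact prod_mulVg : left_inverse prod_one prod_inv prod_mul.
Proof. by move=> f; apply: functional_extensionality_dep => a; exact: mulVg. Qed.
Fact prod_mulgV : right_inverse prod_one prod_inv prod_mul.
Proof. by move=> f; apply: functional_extensionality_dep => a; exact: mulgV. Qed.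

HB.instance Definition _ := isGroup.Build P
  prod_mulgA prod_mul1g prod_mulg1 prod_mulVg prod_mulgV.

Lemma cvg_prod_group (F : set_system P) (FF : Filter F) (f : P) :
  F --> f <-> forall a, (fun g : P => g a) @ F --> f a.
Proof.
split=> [Ff a|Ff].
  have /cvg_sup/(_ a) Fa := Ff.
  apply: cvg_trans (@initial_continuous _ _ (fun g : P => g a) f).
  exact: cvg_app.
apply/cvg_sup => a V [_ [[W oW <-] Wf WV]].
by apply: filterS WV _; apply: (Ff a); exact: open_nbhs_nbhs.
Qed.

Lemma prod_group_proj_continuous a : continuous (fun f : P => f a).
Proof. by move=> f; apply: ((@cvg_prod_group (nbhs f) _ f).1). Qed.

Lemma prod_mulg_continuous : continuous (fun x : P * P => x.1 * x.2).
Proof.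
move=> [f g]; apply/cvg_prod_group => a.
apply: (@continuous_comp _ _ _ (fun x : P * P => (x.1 a, x.2 a))
  (fun x : G_ a * G_ a => x.1 * x.2)); last exact: mulg_continuous.
by apply: cvg_pair => /=;
  [apply: (cvg_comp fst (fun x : P => x a))|
   apply: (cvg_comp snd (fun x : P => x a))];
  [exact: cvg_fst|exact: prod_group_proj_continuous|
   exact: cvg_snd|exact: prod_group_proj_continuous].
Qed.

Lemma prod_invg_continuous : continuous (fun x : P => x^-1).
Proof.
move=> f; apply/(@cvg_prod_group _ (fmap_filter _ (nbhs_filter f))) => a.
apply: (@continuous_comp _ _ _ (fun x : P => x a) (fun x : G_ a => x^-1)).
  exact: prod_group_proj_continuous.
exact: invg_continuous.
Qed.

HB.instance Definition _ := isTopologicalGroup.Build P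
  prod_mulg_continuous prod_invg_continuous.
End prod_group.

Record inverse_system (d : Order.disp_t) (I : preorderType d) :=
  InverseSystem {
  inverse_system_obj :> I -> topologicalGroupType ;
  inverse_system_map : forall i j : I, (i <= j)%O ->
    {multiplicative inverse_system_obj j -> inverse_system_obj i} ;
  inverse_system_map_continuous : forall i j (ij : (i <= j)%O),
    continuous (inverse_system_map ij) ;
  inverse_system_map_id : forall i (ii : (i <= i)%O) x,
    inverse_system_map ii x = x ;
  inverse_system_map_comp :
    forall i j k (ij : (i <= j)%O) (jk : (j <= k)%O) (ik : (i <= k)%O) x,
    inverse_system_map ij (inverse_system_map jk x) = inverse_system_map ik x }.

Definition directed (d : Order.disp_t) (I : preorderType d) : Prop :=
  inhabited I /\ forall i j : I, exists k : I, (i <= k)%O /\ (j <= k)%O.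

Section inverse_limit.
Variables (d : Order.disp_t) (I : preorderType d) (S : inverse_system I).

Definition inverse_limit_set : set (prod_group S) :=
  [set f | forall i j (ij : (i <= j)%O), inverse_system_map S ij (f j) = f i].

Fact inverse_limit1 : inverse_limit_set 1.
Proof.
move=> i j ij; apply: (@mulgI _ (inverse_system_map S ij 1)).
by rewrite -gmulfM !mulg1.
Qed.

Fact inverse_limitM f g : inverse_limit_set f -> inverse_limit_set g ->
  inverse_limit_set (f * g).
Proof. by move=> hf hg i j ij; rewrite gmulfM hf hg. Qed.

Fact inverse_limitV f : inverse_limit_set f -> inverse_limit_set f^-1.
Proof.
move=> hf i j ij; apply: (@mulgI _ (f i)); rewrite mulgV.
by rewrite -(hf _ _ ij) -gmulfM mulgV; exact: inverse_limit1.
Qed.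

Definition inverse_limit : subgroup (prod_group S) :=
  Subgroup inverse_limit1 inverse_limitM inverse_limitV.
End inverse_limit.

Section local_direct_product.
Variables (A : Type) (G_ : A -> topologicalGroupType).
Variable U : forall a, compact_open_subgroup (G_ a).

Definition local_direct_product_set : set (prod_group G_) :=
  [set f | finite_set [set a | ~ (U a : set (G_ a)) (f a)]].

Fact local_direct_product1 : local_direct_product_set 1.
Proof.
rewrite /local_direct_product_set /= (_ : [set _ | _] = set0) //.
by apply/seteqP; split=> a //=; apply; exact: subgroup1.
Qed.

Fact local_direct_productM f g :
  local_direct_product_set f -> local_direct_product_set g ->
  local_direct_product_set (f * g).
Proof.
move=> ff fg; apply: sub_finite_set (_ : finite_set (_ `|` _)); last first.
  by rewrite finite_setU; split; [exact: ff|exact: fg].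
move=> a /= nU; apply: contrapT => /not_orP[/contrapT Uf /contrapT Ug].
by apply: nU; exact: subgroupM.
Qed.

Fact local_direct_productV f :
  local_direct_product_set f -> local_direct_product_set f^-1.
Proof.
apply: sub_finite_set => a /= nU Uf; apply: nU; exact: subgroupV.
Qed.

Definition local_direct_product_subgroup : subgroup (prod_group G_) :=
  Subgroup local_direct_product1 local_direct_productM local_direct_productV.

(* A new type rather than [subgroup_group local_direct_product_subgroup], whose
   subspace topology is in general coarser than the one defined here. *)
Record local_direct_product : Type := LocalDirectProduct {
  ldp_val : prod_group G_ ;
  ldp_valP : ldp_val \in (local_direct_product_subgroup : set _) }.

Local Notation L := local_direct_product.

HB.instance Definition _ := [isSub of L for ldp_val].
HB.instance Definition _ := [Choice of L by <:].
HB.instance Definition _ :=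
  @SubChoice_isSubGroup.Build (prod_group G_)
    (fun f => f \in (local_direct_product_subgroup : set _)) L
    (subgroup_closed local_direct_product_subgroup).

Local Notation K := (prod_group (fun a => subgroup_group (U a))).

Fact ldp_incl_subproof (u : K) :
  (fun a => val (u a)) \in (local_direct_product_subgroup : set _).
Proof.
apply/mem_set; rewrite /= /local_direct_product_set /=.
rewrite (_ : [set _ | _] = set0) //.
by apply/seteqP; split=> a //=; apply; exact/set_mem/(valP (u a)).
Qed.

Definition ldp_incl (u : K) : L := LocalDirectProduct (ldp_incl_subproof u).

(* The group topology for which the product of the [U a] is an open subgroup:
   a set is open when its trace on every coset of that subgroup is open for
   the product topology; see [ldp_incl_continuous] and [ldp_incl_open]. *)
Definition ldp_open : set (set L) :=
  [set V | forall f : L, open [set u : K | V (f * ldp_incl u)]].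

Fact ldp_openT : ldp_open setT.
Proof. by move=> f; exact: openT. Qed.

Fact ldp_openI : setI_closed ldp_open.
Proof. move=> V W oV oW f; exact: (@openI K _ _ (oV f) (oW f)). Qed.

Fact ldp_open_bigU (J : Type) (V : J -> set L) :
  (forall j, ldp_open (V j)) -> ldp_open (\bigcup_j V j).
Proof.
by move=> oV f; apply: (@bigcup_open K J setT
  (fun j => [set u | V j (f * ldp_incl u)])) => j _; exact: oV.
Qed.

HB.instance Definition _ :=
  isOpenTopological.Build L ldp_openT ldp_openI ldp_open_bigU.

Lemma ldp_inclM : {morph ldp_incl : u v / u * v}.
Proof.
by move=> u v; apply/val_inj; apply: functional_extensionality_dep.
Qed.

Lemma ldp_incl1 : ldp_incl 1 = 1.
Proof. by apply/val_inj; apply: functional_extensionality_dep. Qed.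

Lemma ldp_inclV (u : K) : ldp_incl u^-1 = (ldp_incl u)^-1.
Proof. by apply: (@mulgI _ (ldp_incl u)); rewrite -ldp_inclM !mulgV ldp_incl1. Qed.

Lemma ldp_incl_inj : injective ldp_incl.
Proof.
move=> u v /(congr1 val) uv; apply: functional_extensionality_dep => a.
by apply/val_inj; exact: (congr1 (fun f : prod_group G_ => f a) uv).
Qed.

Lemma ldp_incl_continuous : continuous ldp_incl.
Proof.
apply/continuousP => V /(_ 1); congr open.
by apply/seteqP; split=> u /=; rewrite mul1g.
Qed.

Lemma nbhs_ldpP (f : L) (V : set L) :
  nbhs f V <-> nbhs (1 : K) [set u | V (f * ldp_incl u)].
Proof.
split.
  case=> W [oW Wf WV]; rewrite nbhsE.
  exists [set u : K | W (f * ldp_incl u)]; last by move=> u /WV.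
  by split; [exact: oW|rewrite /= ldp_incl1 mulg1].
rewrite nbhsE => -[W [oW W1] WV].
exists [set f * ldp_incl u | u in W]; split.
- move=> g; rewrite openE => u /= [w Ww e].
  have gE : g = f * ldp_incl (w * u^-1).
    by rewrite ldp_inclM ldp_inclV mulgA e mulgK.
  have : nbhs u [set u' : K | W (w * u^-1 * u')].
    apply: (@mulg_continuous_l K (w * u^-1) u W); rewrite -mulgA mulVg mulg1.
    exact: open_nbhs_nbhs.
  apply: filterS => u' Wu'; exists (w * u^-1 * u') => //.
  by rewrite ldp_inclM mulgA gE.
- by exists 1 => //; rewrite ldp_incl1 mulg1.
- by move=> _ [u Wu <-]; exact: WV.
Qed.

Lemma ldp_incl_open (W : set K) : open W -> open (ldp_incl @` W).
Proof.
rewrite !openE => oW _ [u Wu <-]; apply/nbhs_ldpP.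
have : nbhs (1 : K) [set v | W (u * v)].
  by apply: (@mulg_continuous_l K u 1 W); rewrite mulg1; exact: oW.
by apply: filterS => v Wv; exists (u * v) => //; rewrite ldp_inclM.
Qed.

(* The [U a] are open, so [g^-1 (\prod_a U a) g] contains a neighbourhood of 1:
   only the finitely many [a] with [g a] outside [U a] impose a condition. *)
Lemma ldp_conjg (g : L) (V : set K) : nbhs (1 : K) V ->
  nbhs (1 : K) [set u | exists2 v, V v & ldp_incl u ^ g = ldp_incl v].
Proof.
move=> nV.
pose g_ : prod_group G_ := val g.
have cU a (x : subgroup_group (U a)) :
    (U a : set _) (g_ a) -> val x ^ g_ a \in (U a : set _).
  move=> Ug; apply/mem_set; rewrite /conjg.
  have Ux := set_mem (valP x).
  by apply: subgroupM; [exact: subgroupV|exact: subgroupM].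
pose c (u : K) : K := fun a =>
  insubd (1 : subgroup_group (U a)) (val (u a) ^ g_ a).
have cc a : continuous (fun x : subgroup_group (U a) => val x ^ g_ a).
  move=> x; apply: (cvg_comp val (fun y : G_ a => y ^ g_ a)).
    exact: subgroup_val_continuous.
  exact: conjg_continuous.
have v1 a : val (1 : subgroup_group (U a)) ^ g_ a = 1.
  have -> : val (1 : subgroup_group (U a)) = 1 by exact: val1.
  by rewrite conj1g.
have F1 : Filter (nbhs (1 : K)) := nbhs_filter (1 : K).
have nU a : nbhs (1 : subgroup_group (U a))
    [set x | val x ^ g_ a \in (U a : set (G_ a))].
  have : nbhs (val (1 : subgroup_group (U a)) ^ g_ a) (U a : set _).
    rewrite v1; apply: open_nbhs_nbhs; split.
      exact: compact_open_subgroup_open.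
    exact: subgroup1.
  move=> nUa; have nU1 : nbhs (1 : subgroup_group (U a))
      [set x | (U a : set _) (val x ^ g_ a)] by exact: (cc a 1 _ nUa).
  by apply: filterS nU1 => x Ux; exact/mem_set.
have c1 : c u @[u --> (1 : K)] --> (1 : K).
  apply/(@cvg_prod_group _ _ _ (fmap_filter _ (nbhs_filter (1 : K)))) => a.
  move=> W /nbhs_subgroupP[B nB BW].
  have nB' : nbhs (val (1 : subgroup_group (U a)) ^ g_ a) B.
    by rewrite v1; have <- // : val (1 : subgroup_group (U a)) = 1 by exact: val1.
  have nx : nbhs (1 : subgroup_group (U a)) [set x |
      W (insubd (1 : subgroup_group (U a)) (val x ^ g_ a))].
    have nB1 : nbhs (1 : subgroup_group (U a)) [set x | B (val x ^ g_ a)].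
      exact: (cc a 1 B nB').
    apply: filterS (filterI nB1 (nU a)) => x [Bx Ux]; apply: BW.
    by rewrite /preimage /= insubdK.
  exact: (@prod_group_proj_continuous _ _ a (1 : K) _ nx).
have fE : nbhs (1 : K) [set u | forall a, val (u a) ^ g_ a \in (U a : set (G_ a))].
  have /(@finite_seqP {classic A})[s Es] :
      finite_set [set a | ~ (U a : set (G_ a)) (g_ a)] := set_mem (valP g).
  have ns : nbhs (1 : K) [set u | forall a, a \in s ->
      val (u a) ^ g_ a \in (U a : set (G_ a))].
    elim: s {Es} => [|a s IH]; first by apply: (@filterS K _ F1 _ _ _ (@filterT K _ F1)) => u _ b; rewrite in_nil.
    have na : nbhs (1 : K) [set u | val (u a) ^ g_ a \in (U a : set (G_ a))].
      exact: (@prod_group_proj_continuous _ _ a (1 : K) _ (nU a)).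
    apply: filterS (filterI na IH) => u [ua us] b.
    by rewrite inE => /predU1P[->|/us].
  apply: filterS ns => u us a.
  have [Ua|nUa] := pselect ((U a : set (G_ a)) (g_ a)); first exact: cU.
  have sa : [set` s] a by rewrite -Es.
  exact: us sa.
have c1V : nbhs (1 : K) [set u | V (c u)] by exact: (c1 _ nV).
apply: filterS (filterI c1V fE) => u [Vcu uU]; exists (c u) => //.
apply/val_inj; apply: functional_extensionality_dep => a.
rewrite -[RHS]/(val (c u a)) [RHS]insubdK //; exact: uU.
Qed.

Lemma ldp_mulg_continuous : continuous (fun x : L * L => x.1 * x.2).
Proof.
move=> [f g] V /nbhs_ldpP /= nV.
have : nbhs ((1 : K) * 1) [set u | V (f * g * ldp_incl u)] by rewrite mulg1.
move=> /nbhs_mulg[B [C [nB nC BC]]].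
exists ([set f * ldp_incl u | u in [set u : K | exists2 v, B v & ldp_incl u ^ g = ldp_incl v]],
  [set g * ldp_incl u | u in C]) => /=.
  split; apply/nbhs_ldpP.
    by apply: filterS (ldp_conjg g nB) => u Bu; exists u.
  by apply: filterS nC => u Cu; exists u.
move=> [_ _] [/= [u [v Bv e] <-] [w Cw <-]].
suff -> : f * ldp_incl u * (g * ldp_incl w) = f * g * ldp_incl (v * w).
  exact: BC.
by rewrite ldp_inclM -e /conjg !mulgA mulgK.
Qed.

Lemma ldp_invg_continuous : continuous (fun x : L => x^-1).
Proof.
move=> f V /nbhs_ldpP nV; apply/nbhs_ldpP.
have : nbhs ((1 : K)^-1) [set u | V (f^-1 * ldp_incl u)] by rewrite invg1.
move=> /invg_continuous/(ldp_conjg f^-1).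
apply: filterS => u [v Vv e].
rewrite /= (_ : (f * ldp_incl u)^-1 = f^-1 * ldp_incl v^-1) //.
by rewrite ldp_inclV -e /conjg !invgM !invgK !mulgA mulVg mul1g.
Qed.

HB.instance Definition _ := isTopologicalGroup.Build L
  ldp_mulg_continuous ldp_invg_continuous.
End local_direct_product.

Inductive elementary : topologicalGroupType -> Prop :=
| elementary_profinite (G : topologicalGroupType) :
    profinite G -> @second_countable G -> elementary G
| elementary_discrete (G : topologicalGroupType) :
    countable [set: G] -> discrete_group G -> elementary G
| elementary_extension (G : topologicalGroupType) (H : normal_subgroup G) :
    tdlcsc G -> closed H -> elementary (subgroup_group H) ->
    profinite (quotient_group H) \/ discrete_group (quotient_group H) ->
    elementary G
| elementary_union (G : topologicalGroupType) (O : nat -> subgroup G) :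
    tdlcsc G -> (forall i, open (O i)) -> (forall i, O i `<=` O i.+1) ->
    \bigcup_i (O i : set G) = setT ->
    (forall i, elementary (subgroup_group (O i))) ->
    elementary G.

Lemma elementary_tdlcsc (G : topologicalGroupType) : elementary G -> tdlcsc G.
Proof.
case=> {}G //.
  move=> [cG hG tdG] sG; split=> // x _.
  by exists setT; [exact: filterT|split=> //; exact: closedT].
move=> cG oG.
have clopenG (A : set G) : clopen A.
  by split=> //; rewrite -[A]setCK; apply: open_closedC.
split.
- apply: zero_dimension_totally_disconnected => x y xy.
  by exists [set x]; split=> // /esym/eqP; exact/negP.
- move=> x _; exists [set x].
    by apply: open_nbhs_nbhs; split.
  by split; [exact: compact_set1|exact: (clopenG _).2].
- exists (range (fun x : G => [set x])).
    by apply: sub_countable cG; exact: card_image_le.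
  split; first by move=> A _; exact: oG.
  move=> x V /nbhs_singleton Vx; exists [set x]; last by move=> _ ->.
  by split=> //; exists x.
- move=> x y /(_ [set x] [set y]) h.
  have [|| z [/= -> <-]] // := h.
    by apply: open_nbhs_nbhs; split.
  by apply: open_nbhs_nbhs; split.
Qed.

Definition residually_elementary (G : topologicalGroupType) : Prop :=
  forall g : G, g <> 1 -> exists N : normal_subgroup G,
    [/\ closed N, elementary (quotient_group N) & ~ (N : set G) g].

(* The product is taken in increasing order of the indices. *)
Definition multiplication_map (G : topologicalGroupType) (k : nat)
    (N : 'I_k -> normal_subgroup G)
    (x : prod_group (fun i => subgroup_group (N i))) : G :=
  \prod_(i < k) val (x i).

Definition quasi_product (G : topologicalGroupType) (k : nat)
    (N : 'I_k -> normal_subgroup G) : Prop :=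
  [/\ forall i, closed (N i), injective (@multiplication_map G k N) &
      dense (range (@multiplication_map G k N))].

(* Main.v *)
(* Let [residual P] be the intersection of the open normal subgroups of [P], and
   let [res_elementary] be the smallest class of t.d.l.c.s.c. groups that
   contains the trivial groups and contains [G] as soon as it contains
   [residual P] for every compactly generated open subgroup [P] of [G].  It is
   the class of elementary groups.  Indeed a continuous morphism sends residuals
   into residuals, so an induction shows at once that a group mapping to the
   class with kernel in the class is in the class, which gives (1) and (2), and
   that elementary groups are in the class.  Conversely, when [P] is compactly
   generated, [P / residual P] has a compact open normal subgroup, hence is
   elementary, and [G] is a countable increasing union of such [P].

   For (4), if [V] is compact open in [P], finitely many kernels already cut [V]
   down to a subgroup that is normal in [P]; (6) is a special case.  For (7), [P]
   is contained in [C_i V] for some [i] by density, so [residual P] is contained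
   in [C_i].  For (3) and (5), one shows by induction on [K] in the class that if
   [K] is a closed normal subgroup of [G] and [p : G -> L] is open, then the
   closure of [p K] is in the class: it is the closure of the union of the
   closures of the [p P], which have open normalizers by continuity of the
   conjugation action on [K], and the closure of [p P] is an extension of the
   closure of [p (residual P)] by a compact group and a group with open centre. *)

Require Import Defs.
From mathcomp Require Import all_boot all_order.
From mathcomp Require Import all_classical.
From mathcomp Require Import reals topology function_spaces.

Set Implicit Arguments.
Unset Strict Implicit.
Unset Printing Implicit Defensive.

Local Open Scope classical_set_scope.
Local Open Scope group_scope.

(** * Continuity of the group operations and uses of compactness *)

Local Notation "x \isin H" := (subgroup_set H x) (at level 70, only parsing).

Lemma subgroupJ (G : groupType) (H : subgroup G) x y : x \isin H ->
  y \isin H -> x ^ y \isin H.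
Proof.
by move=> Hx Hy; rewrite /conjg; apply: subgroupM;
  [exact: subgroupV|exact: subgroupM].
Qed.

Section continuity.
Variable G : topologicalGroupType.

Lemma cvg_mulg (T : Type) (F : set_system T) (FF : Filter F) (f g : T -> G) a b :
  f @ F --> a -> g @ F --> b -> (fun x => f x * g x) @ F --> a * b.
Proof.
move=> fa gb; apply: (cvg_comp2 fa gb).
exact: (@mulg_continuous G (a, b)).
Qed.

Lemma cvg_invg (T : Type) (F : set_system T) (FF : Filter F) (f : T -> G) a :
  f @ F --> a -> (fun x => (f x)^-1) @ F --> a^-1.
Proof. by move=> fa; apply: (cvg_comp _ _ fa); exact: invg_continuous. Qed.

Lemma cvg_conjg (T : Type) (F : set_system T) (FF : Filter F) (f g : T -> G) a b :
  f @ F --> a -> g @ F --> b -> (fun x => f x ^ g x) @ F --> a ^ b.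
Proof.
by move=> fa gb; apply: cvg_mulg; [exact: cvg_invg|exact: cvg_mulg].
Qed.

Lemma nbhs1_mull (x : G) (A : set G) :
  nbhs x A <-> nbhs (1 : G) [set y | A (x * y)].
Proof.
split=> [nA|].
  by apply: (@mulg_continuous_l G x 1 A); rewrite mulg1.
move=> nA; have : nbhs x [set y | A (x * (x^-1 * y))].
  by apply: (@mulg_continuous_l G x^-1 x [set y | A (x * y)]); rewrite mulVg.
by apply: filterS => y /=; rewrite mulVKg.
Qed.

Lemma subgroup_open (H : subgroup G) : nbhs (1 : G) H -> open H.
Proof.
move=> nH; rewrite openE => x Hx; apply/nbhs1_mull.
by apply: filterS nH => y Hy; exact: subgroupM.
Qed.

Lemma open_subgroup_nbhs (H : subgroup G) : open H -> nbhs (1 : G) H.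
Proof. by move=> oH; apply: open_nbhs_nbhs; split=> //; exact: subgroup1. Qed.

Lemma open_subgroup_closed (H : subgroup G) : open H -> closed H.
Proof.
move=> oH x /(_ [set y | y \isin H -> x \isin H]) []; last first.
  by move=> y [Hy] /(_ Hy).
apply/nbhs1_mull; apply: filterS (open_subgroup_nbhs oH) => y Hy /= Hxy.
by rewrite -(mulgK y x); apply: subgroupM => //; exact: subgroupV.
Qed.

(** This is the tube lemma for the map [(z, x) |-> x ^ z]: near a fixed [x] the condition holds
    around every [z], and compactness of [Z] makes the neighbourhood of [x] uniform. *)
Lemma compact_conjg_open (Z A : set G) : compact Z -> open A ->
  open [set x | forall z, Z z -> A (x ^ z)].
Proof.
move=> /compact_near_coveringP cZ oA; rewrite openE => x Ax.
apply: (cZ G (nbhs x) (fun x z => A (x ^ z))) => z Zz.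
have : (fun p : G * G => p.2 ^ p.1) @ (z, x) --> x ^ z.
  by apply: cvg_conjg; [exact: cvg_snd|exact: cvg_fst].
by apply; apply: open_nbhs_nbhs; split=> //; exact: Ax.
Qed.

Lemma compact_mulg_open (Z A : set G) : compact Z -> open A ->
  open [set x | forall z, Z z -> A (z * x)].
Proof.
move=> /compact_near_coveringP cZ oA; rewrite openE => x Ax.
apply: (cZ G (nbhs x) (fun x z => A (z * x))) => z Zz.
have : (fun p : G * G => p.1 * p.2) @ (z, x) --> z * x.
  by apply: cvg_mulg; [exact: cvg_fst|exact: cvg_snd].
by apply; apply: open_nbhs_nbhs; split=> //; exact: Ax.
Qed.

Lemma compact_image (S T : topologicalType) (f : S -> T) (A : set S) :
  continuous f -> compact A -> compact (f @` A).
Proof.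
by move=> cf cA; apply: continuous_compact => //; exact: continuous_subspaceT.
Qed.

Lemma compact_invg (Z : set G) : compact Z -> compact [set z^-1 | z in Z].
Proof. by apply: compact_image; exact: invg_continuous. Qed.

Lemma compact_mulg (Y Z : set G) : compact Y -> compact Z ->
  compact [set x.1 * x.2 | x in Y `*` Z].
Proof.
move=> cY cZ; apply: compact_image; first exact: mulg_continuous.
exact: compact_setX.
Qed.
End continuity.

(** [O] and the complements of the closed sets [f i] cover [K]; a finite subcover involves finitely
    many indices, and directedness replaces them by one. This turns knowledge of an intersection of
    subgroups into knowledge of a single member of the family. *)
Lemma compact_directed (I : Type) (T : topologicalType) (K : set T) (D : set I)
    (f : I -> set T) (O : set T) :
  compact K -> D !=set0 ->
  (forall i j, D i -> D j -> exists2 k, D k & f k `<=` f i `&` f j) ->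
  (forall i, D i -> closed (f i)) -> open O ->
  (forall x, K x -> (forall i, D i -> f i x) -> O x) ->
  exists2 i, D i & K `&` f i `<=` O.
Proof.
move=> /compact_near_coveringP cK [i0 Di0] dD cD oO KO.
(* [F] is the filter of tails of the directed family, so that compactness can be used in its
   near-covering form. *)
pose F : set_system I := filter_from D (fun i => [set j | D j /\ f j `<=` f i]).
have FF : Filter F.
  apply: filter_from_filter; first by exists i0.
  move=> i j Di Dj; have [k Dk kij] := dD i j Di Dj; exists k => //.
  by move=> l [Dl lk]; split; split=> // x /lk/kij[].
have [i Di fi] : \near F, K `<=` (fun i x => f i x -> O x) F.
  apply: cK => x Kx; have [Ox|nOx] := pselect (O x).
    exists (O, setT) => /=; last by move=> [y i] [].
    by split; [exact: open_nbhs_nbhs|exact: filterT].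
  have /existsNP[i /not_implyP[Di nfi]] : ~ forall i, D i -> f i x.
    by move=> /KO; apply: contra_not nOx; apply.
  exists (~` f i, [set j | D j /\ f j `<=` f i]) => /=.
    split; last by exists i.
    by apply: open_nbhs_nbhs; split=> //; apply: closed_openC; exact: cD.
  by move=> [y j] /= [nfy [_ ji]] /ji.
by exists i => // x [Kx fx]; apply: (fi i) => //; split.
Qed.

(** * Van Dantzig's theorem *)

Section van_dantzig.
Variable G : topologicalGroupType.
Hypotheses (tdG : totally_disconnected [set: G])
  (lcG : locally_compact [set: G]) (hG : hausdorff_space G).

(** By compactness of [A] some neighbourhood [W] of 1 satisfies [a * w1 * w2^-1 \notin B] for all
    [a] in [A] and [w1], [w2] in [W]; then [A W] and [B W] are disjoint. *)
Lemma compact_disjoint_open (A B : set G) : compact A -> compact B ->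
  A `&` B = set0 ->
  exists U V : set G, [/\ open U, open V, A `<=` U, B `<=` V & U `&` V = set0].
Proof.
move=> cA cB AB0.
have oB : open (~` B) by apply: closed_openC; exact: compact_closed.
have /open_nbhs_nbhs : open_nbhs (1 : G) [set x | forall a, A a -> (~` B) (a * x)].
  split; first exact: compact_mulg_open.
  move=> a Aa; rewrite mulg1 => Ba; suff : set0 a by [].
  by rewrite -AB0.
rewrite -{1}(mulgV (1 : G)) => /nbhs_mulg[W1 [W2 [nW1 /invg_continuous nW2 W12]]].
have nW12 : nbhs (1 : G) (W1 `&` [set x | W2 x^-1]) by exact: filterI.
have nW := nbhs_interior nW12.
set W := _° in nW; have oW : open W by exact: open_interior.
have WE w1 w2 : W w1 -> W w2 -> forall a, A a -> ~ B (a * (w1 * w2^-1)).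
  by move=> /interior_subset[? _] /interior_subset[_ ?]; exact: W12.
have oX (X : set G) : open [set x | exists2 a, X a & W (a^-1 * x)].
  have -> : [set x | exists2 a, X a & W (a^-1 * x)] =
      \bigcup_(a in X) ((fun x => a^-1 * x) @^-1` W).
    by apply/seteqP; split=> y [a Xa Wa]; exists a.
  apply: bigcup_open => a _; apply: open_comp => // y _; exact: mulg_continuous_l.
exists [set x | exists2 a, A a & W (a^-1 * x)], [set x | exists2 b, B b & W
  (b^-1 * x)].
split=> //.
- by move=> a Aa; exists a => //; rewrite mulVg; exact: (nbhs_singleton nW).
- by move=> b Bb; exists b => //; rewrite mulVg; exact: (nbhs_singleton nW).
- apply/seteqP; split=> // y [[a Aa Wa] [b Bb Wb]].
  by apply: (WE _ _ Wa Wb a Aa); rewrite invgM invgK !mulgA mulgV mul1g mulgV mul1g.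
Qed.

(* The quasicomponent of [x] in a compact neighbourhood is connected, hence
   equal to [x]. *)
Lemma compact_open_base (x : G) (A : set G) : nbhs x A ->
  exists C : set G, [/\ compact C, open C, C x & C `<=` A].
Proof.
move=> nA; have [B] := lcG (I : [set: G] x).
rewrite withinET => nB [cB clB].
(* The members of [D] are the relatively clopen subsets of [B] containing [x]; their intersection
   [Q] is the quasicomponent of [x] in [B]. *)
pose D := [set S : set G | [/\ closed S, closed (B `\` S), S x & S `<=` B]].
have DB : D B.
  by split=> //; [rewrite setDv; exact: closed0|exact: nbhs_singleton].
have D0 : D !=set0 by exists B.
have DI S S' : D S -> D S' -> exists2 S'', D S'' & S'' `<=` S `&` S'.
  move=> [cS cBS Sx SB] [cS' cBS' Sx' SB']; exists (S `&` S') => //; split=> //.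
  - exact: closedI.
  - by rewrite setDIr; exact: closedU.
  - by move=> y [/SB].
have Dcl S : D S -> closed S by case.
pose Q := \bigcap_(S in D) S.
have QB : Q `<=` B by move=> y; exact.
have clQ : closed Q by apply: closed_bigI => S /Dcl.
have Qx : Q x by move=> S [].
have Qcon : connected Q.
  apply/connectedP => E [E0 QE sE].
  wlog Ex : E E0 QE sE / E false x.
    move=> h; move: Qx; rewrite QE => -[|Ex]; first exact: h.
    apply: (h (E \o negb)) => //=.
    - by rewrite setUC.
    - by rewrite separatedC.
  have [s1 s2] := sE.
  have EQ b : E b `<=` Q by rewrite QE; case: b => y Ey; [right|left].
  have Ecl b : closed (E b).
    move=> y Ey; have := clQ y (closureS (@EQ b) Ey).
    rewrite {1}QE; case: b Ey => Ey [] // E'y; exfalso; suff : set0 y by [].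
      by rewrite -s2; split.
    by rewrite -s1; split.
  have Eco b : compact (E b).
    by apply: subclosed_compact (Ecl b) cB _ => y /EQ/QB.
  have E01 : E false `&` E true = set0 by exact: separated_disjoint.
  have [U [V [oU oV EU EV UV]]] := compact_disjoint_open (Eco false) (Eco true) E01.
  have [S DS BS] : exists2 S, D S & B `&` S `<=` U `|` V.
    apply: (compact_directed cB D0 DI Dcl (openU oU oV)) => y By Qy.
    have : Q y by [].
    by rewrite QE => -[/EU|/EV]; [left|right].
  have nUV y : U y -> V y -> False.
    by move=> Uy Vy; suff : set0 y by []; rewrite -UV.
  (* As [S] is covered by the disjoint open sets [U] and [V], removing [V] leaves a set clopen in
     [B]. Hence [Q] avoids [V], although it contains the non-empty piece [E true]. *)
  have : D (S `\` V).
    have [cS cBS Sx SB] := DS; split.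
    - by rewrite setDE; apply: closedI => //; exact: open_closedC.
    - rewrite (_ : _ `\` _ = (B `\` S) `|` (S `&` ~` U)).
        by apply: closedU => //; apply: closedI => //; exact: open_closedC.
      apply/seteqP; split=> y.
        move=> [By nSV]; have [Sy|nSy] := pselect (S y); [right|by left].
        by split=> // Uy; apply: nSV; split=> // Vy; exact: (nUV y).
      move=> [[By nSy]|[Sy nUy]]; first by split=> // -[].
      by split; [exact: SB|move=> [_ nVy]; have [] := BS y (conj (SB y Sy) Sy)].
    - by split=> // Vx; apply: (nUV x) => //; exact: EU.
    - by move=> y [/SB].
  move=> DSV; have [y Ey] := E0 true.
  by have [_] := EQ _ _ Ey _ DSV; apply; exact: EV.
have Q1 y : Q y -> y = x.
  move=> Qy; have : connected_component [set: G] x y by exists Q.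
  by rewrite tdG.
have [S [cS cBS Sx SB] BS] : exists2 S, D S & B `&` S `<=` (A `&` B)°.
  apply: (compact_directed cB D0 DI Dcl (open_interior _)) => y By Qy.
  have /Q1 -> : Q y by []; exact: filterI.
have SAB y : S y -> (A `&` B)° y by move=> Sy; apply: BS; split=> //; exact: SB.
exists S; split=> //.
- exact: subclosed_compact cB SB.
(* [S] is open in [G], not merely in [B], because it lies in the interior of [B]. *)
- have -> : S = (A `&` B)° `&` ~` (B `\` S).
    apply/seteqP; split=> y.
      by move=> Sy; split; [exact: SAB|case].
    by move=> [/interior_subset[_ By] nS]; apply: contrapT => nSy; exact: nS.
  by apply: openI; [exact: open_interior|exact: closed_openC].
- by move=> y /SAB/interior_subset[].
Qed.

(** The elements whose right translation, together with that of their inverse, maps a compact open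
    neighbourhood [C] of 1 into itself form a subgroup. It is open because [C] is compact and open,
    and it lies in [C] because [C] contains 1. *)
Lemma compact_open_subgroup_base (A : set G) : nbhs (1 : G) A ->
  exists U : subgroup G, [/\ compact U, open U & U `<=` A].
Proof.
move=> /compact_open_base[C [cC oC C1 CA]].
pose V := [set x | (forall c, C c -> C (c * x)) /\ (forall c, C c -> C (c * x^-1))].
have V1 : V 1 by rewrite /V /= invg1; split=> c; rewrite mulg1.
have VM x y : V x -> V y -> V (x * y).
  move=> [Cx Cx'] [Cy Cy']; split=> c Cc; rewrite ?invgM mulgA.
    by apply: Cy; exact: Cx.
  by apply: Cx'; exact: Cy'.
have VV x : V x -> V x^-1 by move=> [Cx Cx']; split; rewrite ?invgK.
pose U := Subgroup V1 VM VV.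
have VC : U `<=` C by move=> x [Cx _]; rewrite -(mul1g x); exact: Cx.
have oU : open U.
  apply: subgroup_open; have o := compact_mulg_open cC oC.
  apply: filterI.
    by apply: open_nbhs_nbhs; split=> // c; rewrite mulg1.
  apply: (@invg_continuous _ (1 : G) [set x | forall c, C c -> C (c * x)]).
  by rewrite invg1; apply: open_nbhs_nbhs; split=> // c; rewrite mulg1.
exists U; split=> //; last by move=> x /VC/CA.
by apply: subclosed_compact cC VC; exact: open_subgroup_closed.
Qed.
End van_dantzig.

(** * Subgroups and their closures *)

Section morphisms.
Variables (G H : groupType) (f : G -> H).
Hypothesis fM : {morph f : x y / x * y}.

Lemma morph_g1 : f 1 = 1.
Proof. by apply: (@mulgI _ (f 1)); rewrite -fM !mulg1. Qed.

Lemma morph_gV x : f x^-1 = (f x)^-1.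
Proof. by apply: (@mulgI _ (f x)); rewrite -fM !mulgV morph_g1. Qed.

Lemma morph_gJ x y : f (x ^ y) = f x ^ f y.
Proof. by rewrite /conjg !fM morph_gV. Qed.

Definition preimage_subgroup (K : subgroup H) : subgroup G.
Proof.
apply: (@Subgroup _ (f @^-1` K)); rewrite /preimage /=.
- by rewrite morph_g1; exact: subgroup1.
- by move=> x y; rewrite fM; exact: subgroupM.
- by move=> x; rewrite morph_gV; exact: subgroupV.
Defined.

Definition image_subgroup (K : subgroup G) : subgroup H.
Proof.
apply: (@Subgroup _ (f @` K)).
- by exists 1; [exact: subgroup1|exact: morph_g1].
- by move=> _ _ [x Kx <-] [y Ky <-]; exists (x * y); [exact: subgroupM|exact: fM].
- by move=> _ [x Kx <-]; exists x^-1; [exact: subgroupV|exact: morph_gV].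
Defined.
End morphisms.

Section subgroup_constructions.
Variable G : groupType.
Implicit Types (A : set G) (H K : subgroup G).

Definition trivial_subgroup : subgroup G.
Proof.
apply: (@Subgroup _ [set 1]) => //= [x y -> ->|x ->]; first exact: mulg1.
exact: invg1.
Defined.

Definition full_subgroup : subgroup G.
Proof. exact: (@Subgroup _ [set: G]). Defined.

Definition setI_subgroup H K : subgroup G.
Proof.
apply: (@Subgroup _ (H `&` K)).
- by split; exact: subgroup1.
- by move=> x y [? ?] [? ?]; split; exact: subgroupM.
- by move=> x [? ?]; split; exact: subgroupV.
Defined.

Definition generated A : subgroup G.
Proof.
apply: (@Subgroup _ [set x | forall K, A `<=` K -> x \isin K]).
- by move=> K _; exact: subgroup1.
- by move=> x y hx hy K AK; apply: subgroupM; [exact: hx|exact: hy].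
- by move=> x hx K AK; apply: subgroupV; exact: hx.
Defined.

Lemma generated_sub A : A `<=` generated A.
Proof. by move=> x Ax K; exact. Qed.

Lemma generated_min A K : A `<=` K -> generated A `<=` K.
Proof. by move=> AK x; exact. Qed.

(** The equivalence makes this a subgroup for an arbitrary set [A]: it is the normalizer when [A] is
    a subgroup, and a centralizer when [A] is a singleton. *)
Definition stabilizer A : subgroup G.
Proof.
apply: (@Subgroup _ [set g | forall x, A (x ^ g) <-> A x]).
- by move=> x; rewrite conjg1.
- by move=> g h hg hh x; rewrite conjgM hh.
- by move=> g hg x; rewrite -(hg (x ^ g^-1)) conjgKV.
Defined.

Lemma stabilizerP A g : (forall x, A x -> A (x ^ g)) ->
  (forall x, A x -> A (x ^ g^-1)) -> g \isin stabilizer A.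
Proof. by move=> h1 h2 x; split=> [/h2|/h1//]; rewrite conjgK. Qed.

Lemma stabilizerJ A g x : g \isin stabilizer A -> A x -> A (x ^ g).
Proof. by move=> /(_ x) [_]. Qed.

Lemma stabilizerJV A g x : g \isin stabilizer A -> A x -> A (x ^ g^-1).
Proof. by move=> /subgroupV; exact: stabilizerJ. Qed.

Lemma stabilizer_self H : H `<=` stabilizer H.
Proof.
by move=> g Hg; apply: stabilizerP => x Hx; apply: subgroupJ => //;
  exact: subgroupV.
Qed.

Lemma stabilizer_normalizer H : (stabilizer H : set G) = normalizer H.
Proof.
apply/seteqP; split=> g /=; last first.
  move=> e; have h x : x \isin H -> x ^ g^-1 \isin H.
    by rewrite -{1}e => -[y Hy <-]; rewrite conjgK.
  apply: stabilizerP => // x Hx.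
  by rewrite -[X in X _]e; exists x.
move=> hg; apply/seteqP; split=> [_ [x Hx <-]|x Hx]; first exact: stabilizerJ.
by exists (x ^ g^-1); [exact: stabilizerJV|rewrite conjgKV].
Qed.

(** This is the product [H K], described as a union of cosets of [K]. *)
Definition mul_subgroup H K (HK : H `<=` stabilizer K) : subgroup G.
Proof.
apply: (@Subgroup _ [set x | exists2 h, h \isin H & h^-1 * x \isin K]).
- by exists 1; rewrite ?mulg1 ?invg1; exact: subgroup1.
- move=> x y [h Hh Khx] [h' Hh' Kh'y]; exists (h * h'); first exact: subgroupM.
  rewrite (_ : _ * _ = ((h^-1 * x) ^ h') * (h'^-1 * y)).
    by apply: subgroupM => //; apply: stabilizerJ => //; exact: HK.
  by rewrite /conjg invgM !mulgA mulgK.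
- move=> x [h Hh Khx]; exists h^-1; first exact: subgroupV.
  rewrite (_ : _ * _ = ((h^-1 * x)^-1) ^ h^-1).
    by apply: stabilizerJV; [exact: HK|exact: subgroupV].
  by rewrite /conjg !invgM !invgK !mulgA mulgK.
Defined.
End subgroup_constructions.

Section closure_subgroup.
Variable G : topologicalGroupType.

Lemma closureP (A : set G) x :
  closure A x <-> (forall B, nbhs (1 : G) B -> exists2 a, A a & B (x^-1 * a)).
Proof.
split=> [h B nB|h B nB].
  have /h[a [Aa Ba]] : nbhs x [set y | B (x^-1 * y)].
    apply/nbhs1_mull; apply: filterS nB => y By /=; by rewrite mulKg.
  by exists a.
have /h[a Aa] := (nbhs1_mull x B).1 nB.
by rewrite /= mulVKg => Ba; exists a.
Qed.

Definition closure_subgroup (H : subgroup G) : subgroup G.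
Proof.
apply: (@Subgroup _ (closure H)).
- by apply: subset_closure; exact: subgroup1.
- move=> x y Hx Hy B /nbhs_mulg[B1 [B2 [nB1 nB2 B12]]].
  have [a [Ha Ba]] := Hx _ nB1; have [b [Hb Bb]] := Hy _ nB2.
  by exists (a * b); split; [exact: subgroupM|exact: B12].
- move=> x Hx B /invg_continuous/Hx[a [Ha Ba]].
  by exists a^-1; split=> //; exact: subgroupV.
Defined.

Lemma closure_subset_closed (A B : set G) : closed B -> A `<=` B ->
  closure A `<=` B.
Proof. by move=> cB /closureS AB x /AB /cB. Qed.

Lemma conjg_preimage_closed (g : G) (A : set G) : closed A ->
  closed [set x | A (x ^ g)].
Proof. by move=> cA; apply: preimage_closed cA => x _; exact: conjg_continuous. Qed.

Lemma stabilizer_closure (A : set G) : stabilizer A `<=` stabilizer (closure A).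
Proof.
move=> g Ag; apply: stabilizerP.
  apply: closure_subset_closed.
    by apply: conjg_preimage_closed; exact: closed_closure.
  by move=> x Ax; apply: subset_closure; exact: stabilizerJ.
apply: closure_subset_closed.
  by apply: conjg_preimage_closed; exact: closed_closure.
by move=> x Ax; apply: subset_closure; exact: stabilizerJV.
Qed.

(** Each condition [A (x ^ g)] with [x] in [A] is closed in [g]; the stabilizer is the intersection
    of all of them and of their images under inversion. *)
Lemma stabilizer_closed (A : set G) : closed A -> closed (stabilizer A).
Proof.
move=> cA.
have h : closed [set g | forall x, A x -> A (x ^ g)].
  rewrite (_ : [set g | _] = \bigcap_(x in A) [set g | A (x ^ g)]) //.
  apply: closed_bigI => x _; apply: preimage_closed cA => g _.
  by apply: cvg_conjg; [exact: cvg_cst|exact: cvg_id].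
rewrite (_ : (stabilizer A : set G) = [set g | forall x, A x -> A (x ^ g)] `&`
    (fun g => g^-1) @^-1` [set g | forall x, A x -> A (x ^ g)]).
  by apply: closedI => //; apply: preimage_closed h => g _; exact: invg_continuous.
apply/seteqP; split=> g.
  by move=> Ag; split=> x Ax; [exact: stabilizerJ|exact: stabilizerJV].
by move=> [h1 h2]; exact: stabilizerP.
Qed.
End closure_subgroup.

(** * Closed subgroups and quotients *)

Section tdlcsc.
Variable G : topologicalGroupType.

Lemma tdlcsc_compact_open (A : set G) : tdlcsc G -> nbhs (1 : G) A ->
  exists U : subgroup G, [/\ compact U, open U & U `<=` A].
Proof. by move=> [tdG lcG _ hG]; exact: compact_open_subgroup_base. Qed.

(** Left cosets of open subgroups are clopen, so separating points from 1 by open subgroups gives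
    zero-dimensionality, hence total disconnectedness and the Hausdorff property. Translates of [K]
    give local compactness. *)
Lemma tdlcsc_intro (K : set G) :
  (forall x : G, x <> 1 -> exists2 U : subgroup G, open U & ~ x \isin U) ->
  nbhs (1 : G) K -> compact K -> @second_countable G -> tdlcsc G.
Proof.
move=> sep nK cK scG.
have zG : zero_dimensional G.
  move=> x y xy; have [|U oU nU] := sep (x^-1 * y).
    by move=> /mulg1_eq; rewrite invgK => /eqP; rewrite (negbTE xy).
  exists ((fun z => x^-1 * z) @^-1` U); split=> //=.
    apply: preimage_clopen; last exact: mulg_continuous_l.
    by split=> //; exact: open_subgroup_closed.
  by rewrite /preimage /= mulVg; exact: subgroup1.
have hG : hausdorff_space G.
  move=> p q pq; apply: contrapT => /eqP /zG[U [[oU cU] Up nUq]].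
  have [||z []//] := pq U (~` U); first exact: open_nbhs_nbhs.
  by apply: open_nbhs_nbhs; split=> //; exact: closed_openC.
split=> //; first exact: zero_dimension_totally_disconnected.
move=> x _; have cxK : compact [set x * k | k in K].
  by apply: compact_image => //; exact: mulg_continuous_l.
exists [set x * k | k in K]; last by split=> //; exact: compact_closed.
rewrite withinET; apply/nbhs1_mull; apply: filterS nK => k Kk.
by exists k.
Qed.

Lemma tdlcsc_separated (x : G) (N : set G) : tdlcsc G -> closed N -> ~ N x ->
  exists U : subgroup G, [/\ compact U, open U & forall u, u \isin U ->
    ~ N (u * x)].
Proof.
move=> tG cN nNx; have [|U [cU oU UN]] := tdlcsc_compact_open tG
  (A := (fun u => u * x) @^-1` (~` N)); last by exists U.
apply: (@mulg_continuous_r G x 1 (~` N)); rewrite mul1g.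
by apply: open_nbhs_nbhs; split=> //; exact: closed_openC.
Qed.

Lemma tdlcsc_closed1 : tdlcsc G -> closed [set (1 : G)].
Proof.
by move=> [_ _ _ hG]; apply: accessible_closed_set1; exact: hausdorff_accessible.
Qed.
End tdlcsc.

Section subgroup_group.
Variables (G : topologicalGroupType) (H : subgroup G).
Local Notation S := (subgroup_group H).

Lemma subgroup_group_valM : {morph (val : S -> G) : x y / x * y}.
Proof. by move=> x y; exact: valM. Qed.

Lemma subgroup_group_val1 : val (1 : S) = 1.
Proof. exact: morph_g1 subgroup_group_valM. Qed.

Lemma subgroup_group_valP (x : S) : val x \isin H.
Proof. exact: set_mem (valP x). Qed.

Section corestriction.
Variables (T : topologicalGroupType) (f : T -> G).
Hypothesis fH : forall t, f t \isin H.

Definition corestrict (t : T) : S := exist _ (f t) (mem_set (fH t)).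

Lemma val_corestrict t : val (corestrict t) = f t. Proof. by []. Qed.

Lemma corestrictM : {morph f : x y / x * y} -> {morph corestrict : x y / x * y}.
Proof. by move=> fM x y; apply: val_inj; rewrite valM; exact: fM. Qed.

Lemma corestrict_continuous : continuous f -> continuous corestrict.
Proof.
move=> cf x V /nbhs_subgroupP[W nW WV].
have nfW : nbhs x (f @^-1` W) by exact: cf.
by apply: filterS nfW => t Wt; exact: WV.
Qed.

Lemma corestrict_inj : injective f -> injective corestrict.
Proof. by move=> fI x y /(congr1 val); exact: fI. Qed.
End corestriction.

Lemma subgroup_group_compact (K : set G) : compact K -> K `<=` H ->
  compact ((val : S -> G) @^-1` K).
Proof.
move=> cK KH F PF FK.
have [p [Kp pF]] := cK (val @ F) _ FK.
exists (exist _ p (mem_set (KH p Kp))); split=> // A B FA /nbhs_subgroupP[W nW WB].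
have FvA : F ((val : S -> G) @^-1` [set val a | a in A]).
  by apply: filterS FA => a Aa; exists a.
have [_ [[a Aa <-] Wa]] := pF _ W FvA nW.
by exists a; split=> //; exact: WB.
Qed.

Lemma subgroup_group_second_countable : @second_countable G -> @second_countable S.
Proof.
move=> [B cB [oB bB]]; exists [set (val : S -> G) @^-1` b | b in B].
  by apply: sub_countable cB; exact: card_image_le.
split.
  move=> _ [b Bb <-]; apply: open_comp; last exact: oB.
  by move=> x _; exact: subgroup_val_continuous.
move=> x V /nbhs_subgroupP[W /bB[b [Bb bx] bW] WV].
exists ((val : S -> G) @^-1` b); first by split=> //; exists b.
by move=> y /bW/WV.
Qed.

Lemma subgroup_group_tdlcsc : tdlcsc G -> closed H -> tdlcsc S.
Proof.
move=> tG cH; have [U [cU oU _]] := tdlcsc_compact_open tG filterT.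
have HU : H `&` U `<=` H by move=> x [].
have cHU : compact (H `&` U) by rewrite setIC; exact: compact_closedI.
apply: (tdlcsc_intro _ _ (subgroup_group_compact cHU HU)).
- move=> x x1; have vx1 : ~ [set (1 : G)] (val x).
    by move=> e; apply: x1; apply: val_inj; rewrite subgroup_group_val1; exact: e.
  have [V [_ oV VN]] := tdlcsc_separated tG (tdlcsc_closed1 tG) vx1.
  exists (preimage_subgroup subgroup_group_valM V).
    by apply: open_comp oV => y _; exact: subgroup_val_continuous.
  by rewrite /= => /subgroupV/VN; apply; rewrite /= mulVg.
- have nU := open_subgroup_nbhs oU; rewrite -subgroup_group_val1 in nU.
  have nVU : nbhs (1 : S) ((val : S -> G) @^-1` U)
    by exact: subgroup_val_continuous.
  apply: filterS nVU => x Ux; split=> //.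
  exact: subgroup_group_valP.
- by apply: subgroup_group_second_countable; case: tG.
Qed.
End subgroup_group.

Section quotient_group.
Variables (G : topologicalGroupType) (N : normal_subgroup G).

Lemma quotient_map1 (x : G) : quotient_map N x = 1 <-> x \isin N.
Proof.
rewrite -(morph_g1 (@quotient_map_multiplicative _ N)).
split=> [/esym/quotient_mapP|Nx]; first by rewrite invg1 mul1g.
by apply/esym/quotient_mapP; rewrite invg1 mul1g.
Qed.

(** If [x] is outside [N], a small open subgroup [V] has [V x] disjoint from [N], so its image
    misses the class of [x]. As the quotient map is open, images of a compact open subgroup and of a
    countable base serve for the quotient. *)
Lemma quotient_group_tdlcsc : tdlcsc G -> closed N -> tdlcsc (quotient_group N).
Proof.
move=> tG cN; have [U [cU oU _]] := tdlcsc_compact_open tG filterT.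
have pM := @quotient_map_multiplicative _ N.
have pc := @quotient_map_continuous _ N.
apply: (@tdlcsc_intro _ (quotient_map N @` U)).
- move=> q; have [x <-] := quotient_map_surj q => /quotient_map1 nNx.
  have [V [_ oV VN]] := tdlcsc_separated tG cN nNx.
  exists (image_subgroup pM V); first exact: quotient_map_open.
  move=> [v Vv /quotient_mapP]; apply: VN; exact: subgroupV.
- rewrite -(morph_g1 pM); apply: nbhs_quotient_map; exact: open_subgroup_nbhs.
- exact: compact_image.
- have [_ _ [B cB [oB bB]] _] := tG.
  exists [set quotient_map N @` b | b in B].
    by apply: sub_countable cB; exact: card_image_le.
  split; first by move=> _ [b Bb <-]; apply: quotient_map_open; exact: oB.
  move=> q; have [x <-] := quotient_map_surj q => V /pc/bB[b [Bb bx] bV].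
  exists (quotient_map N @` b); first by split; [exists b|exists x].
  by move=> _ [y /bV ? <-].
Qed.

Lemma quotient_group_compact (Y : set G) : compact Y ->
  (forall x, exists2 y, Y y & y^-1 * x \isin N) ->
  compact [set: quotient_group N].
Proof.
move=> cY YN; rewrite (_ : [set: _] = quotient_map N @` Y).
  by apply: compact_image => //; exact: quotient_map_continuous.
apply/seteqP; split=> // q _; have [x <-] := quotient_map_surj q.
by have [y Yy Nyx] := YN x; exists y => //; exact/quotient_mapP.
Qed.

Lemma quotient_group_discrete : open N -> discrete_group (quotient_group N).
Proof.
move=> oN A; rewrite openE => q Aq.
have -> : q = q * 1 by rewrite mulg1.
apply/nbhs1_mull.
have n1 : nbhs (1 : quotient_group N) (quotient_map N @` N).
  rewrite -(morph_g1 (@quotient_map_multiplicative _ N)).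
  by apply: nbhs_quotient_map; exact: open_subgroup_nbhs.
by apply: filterS n1 => _ [x /quotient_map1 -> <-] /=; rewrite !mulg1.
Qed.
End quotient_group.

(** * Continuous morphisms and the behaviour of normalizers *)

Definition continuous_morphism (G H : topologicalGroupType) (f : G -> H) : Prop :=
  continuous f /\ {morph f : x y / x * y}.

Section continuous_morphism.
Variables (G H K : topologicalGroupType).

Lemma continuous_morphism_comp (f : G -> H) (g : H -> K) :
  continuous_morphism f -> continuous_morphism g -> continuous_morphism (g \o f).
Proof.
move=> [cf fM] [cg gM]; split; last by move=> x y; rewrite /= fM gM.
by move=> x; apply: continuous_comp; [exact: cf|exact: cg].
Qed.

Lemma continuous_morphism_val (L : subgroup G) :
  continuous_morphism (val : subgroup_group L -> G).
Proof. by split; [exact: subgroup_val_continuous|exact: subgroup_group_valM]. Qed.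

Lemma continuous_morphism_corestrict (L : subgroup H) (f : G -> H)
    (fL : forall x, f x \isin L) :
  continuous_morphism f -> continuous_morphism (corestrict fL).
Proof. by move=> [cf fM]; split;
  [exact: corestrict_continuous|exact: corestrictM]. Qed.

Lemma continuous_morphism_id : continuous_morphism (@id G).
Proof. by split=> // x; exact: cvg_id. Qed.

Lemma continuous_morphism_conjg (g : G) : continuous_morphism (fun x : G => x ^ g).
Proof. by split; [exact: conjg_continuous|move=> x y; exact: conjMg]. Qed.

Lemma continuous_morphism_quotient (N : normal_subgroup G) :
  continuous_morphism (quotient_map N).
Proof. by split; [exact: quotient_map_continuous|exact:
  quotient_map_multiplicative]. Qed.
End continuous_morphism.

Section preimage_subgroup.
Variables (G H : topologicalGroupType) (f : G -> H).
Hypotheses (fM : {morph f : x y / x * y}) (cf : continuous f).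

Lemma preimage_subgroup_open (K : subgroup H) :
  open K -> open (preimage_subgroup fM K).
Proof. by move=> oK; apply: open_comp oK => x _; exact: cf. Qed.

Lemma preimage_subgroup_closed (K : subgroup H) :
  closed K -> closed (preimage_subgroup fM K).
Proof. by move=> cK; apply: preimage_closed cK => x _; exact: cf. Qed.
End preimage_subgroup.

Lemma stabilizer_setI (G : groupType) (H K L : subgroup G) :
  L `<=` stabilizer H -> L `<=` stabilizer K ->
    L `<=` stabilizer (setI_subgroup H K).
Proof.
move=> LH LK g Lg; apply: stabilizerP => x [Hx Kx].
  by split; apply: stabilizerJ => //; [exact: LH|exact: LK].
by split; apply: stabilizerJV => //; [exact: LH|exact: LK].
Qed.

Lemma stabilizer_preimage (G H : groupType) (f : G -> H)
    (fM : {morph f : x y / x * y}) (K : subgroup H) (g : G) :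
  f g \isin stabilizer K -> g \isin stabilizer (preimage_subgroup fM K).
Proof.
move=> Kg; apply: stabilizerP => x Kx; rewrite /preimage_subgroup /= /preimage /=.
  by rewrite (morph_gJ fM); exact: stabilizerJ.
by rewrite (morph_gJ fM) (morph_gV fM); exact: stabilizerJV.
Qed.

Definition normal_of_stabilizer (G : groupType) (H : subgroup G)
  (nH : forall g, g \isin stabilizer H) : normal_subgroup G :=
  NormalSubgroup (fun x g Hx => stabilizerJ (nH g) Hx).

Lemma normal_stabilizer (G : groupType) (N : normal_subgroup G) (g : G) :
  g \isin stabilizer N.
Proof. by apply: stabilizerP => x Nx; exact: normal_subgroupJ. Qed.

(** * Residuals of compactly generated open subgroups *)

Section residual.
Variable G : topologicalGroupType.

(** Everything is phrased inside [G]: [Q] ranges over the open subgroups of [G] that are contained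
    and normal in [P]. Residuals of different [P] can thus be compared in one ambient group. *)
Definition residual (P : subgroup G) : subgroup G.
Proof.
apply: (@Subgroup _ [set x | x \isin P /\ forall Q : subgroup G, open Q ->
  Q `<=` P -> P `<=` stabilizer Q -> x \isin Q]).
- by split=> [|Q _ _ _]; exact: subgroup1.
- move=> x y [Px hx] [Py hy]; split=> [|Q oQ QP PQ]; first exact: subgroupM.
  by apply: subgroupM; [exact: hx|exact: hy].
- move=> x [Px hx]; split=> [|Q oQ QP PQ]; first exact: subgroupV.
  by apply: subgroupV; exact: hx.
Defined.

Lemma residual_sub (P : subgroup G) : residual P `<=` P.
Proof. by move=> x []. Qed.

Lemma residual_closed (P : subgroup G) : open P -> closed (residual P).
Proof.
move=> oP; rewrite (_ : (residual P : set G) = P `&` \bigcap_(Q in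
  [set Q : subgroup G | [/\ open Q, Q `<=` P & P `<=` stabilizer Q]]) (Q : set G)).
  apply: closedI; first exact: open_subgroup_closed.
  by apply: closed_bigI => Q [oQ _ _]; exact: open_subgroup_closed.
apply/seteqP; split=> x [Px hx]; split=> // Q; first by move=> [? ? ?]; exact: hx.
by move=> oQ QP PQ; apply: hx.
Qed.

Definition compactly_generated (P : subgroup G) : Prop :=
  exists2 Z : set G, compact Z & (P : set G) = generated Z.

(** Adding a compact open subgroup to the generators makes the generated subgroup open. *)
Lemma compactly_generated_open_cover (Z : set G) : tdlcsc G -> compact Z ->
  exists P : subgroup G, [/\ open P, compactly_generated P & Z `<=` P].
Proof.
move=> tG cZ; have [U [cU oU _]] := tdlcsc_compact_open tG filterT.
exists (generated (U `|` Z)); split.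
- apply: subgroup_open; apply: filterS (open_subgroup_nbhs oU) => x Ux.
  by apply: generated_sub; left.
- by exists (U `|` Z) => //; exact: compactU.
- by move=> x Zx; apply: generated_sub; right.
Qed.
End residual.

(** The preimage of an open normal subgroup of [P'] meets [P] in an open normal subgroup of [P]. *)
Lemma residual_morphism (G H : topologicalGroupType) (f : G -> H)
    (P : subgroup G) (P' : subgroup H) :
  continuous_morphism f -> open P -> (forall x, x \isin P -> f x \isin P') ->
  forall x, x \isin residual P -> f x \isin residual P'.
Proof.
move=> [cf fM] oP fP x [Px hx]; split; first exact: fP.
move=> Q oQ QP PQ.
have [] : x \isin setI_subgroup P (preimage_subgroup fM Q); last by [].
apply: hx.
- by apply: openI => //; apply: open_comp oQ => y _; exact: cf.
- by move=> y [].
- apply: stabilizer_setI; first exact: stabilizer_self.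
  by move=> g Pg; apply: stabilizer_preimage; apply: PQ; exact: fP.
Qed.

Lemma stabilizer_residual (G : topologicalGroupType) (P : subgroup G) :
  open P -> P `<=` stabilizer (residual P).
Proof.
move=> oP g Pg; apply: stabilizerP => x.
  apply: (residual_morphism (continuous_morphism_conjg g)) => // y Py.
  exact: subgroupJ.
apply: (residual_morphism (continuous_morphism_conjg g^-1)) => // y Py.
by apply: subgroupJ => //; exact: subgroupV.
Qed.

(* In the compactly generated group [P], compactness provides an open normal
   subgroup [Q] of [P] whose trace on [V * residual P], with [V] compact open,
   is normalized by generators of [P]. *)
Lemma residual_cocompact (G : topologicalGroupType) (P : subgroup G) :
  tdlcsc G -> open P -> compactly_generated P ->
  exists (H : subgroup G) (Y : set G),
    [/\ open H, residual P `<=` H, H `<=` P & P `<=` stabilizer H] /\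
    [/\ compact Y, Y `<=` H &
      forall h, h \isin H -> exists2 y, Y y & y^-1 * h \isin residual P].
Proof.
move=> tG oP [Z cZ PZ].
have [V [cV oV VP]] := tdlcsc_compact_open tG (open_subgroup_nbhs oP).
have PR := stabilizer_residual oP.
have VR : V `<=` stabilizer (residual P) by move=> v /VP/PR.
have ZP : Z `<=` P by rewrite PZ; exact: generated_sub.
pose VR' := mul_subgroup VR.
have VVR' : V `<=` VR'.
  by move=> v Vv; exists v => //; rewrite mulVg; exact: subgroup1.
have RVR' : residual P `<=` VR'.
  by move=> r Rr; exists 1; [exact: subgroup1|rewrite invg1 mul1g].
have oVR' : open VR'.
  by apply: subgroup_open; apply: filterS VVR' _; exact: open_subgroup_nbhs.
(* [O] collects the elements whose conjugates by the generators and by their inverses stay in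
   [V * residual P]. It contains [residual P], so by compactness it contains the trace on [V] of a
   single open normal [Q]. *)
pose O := [set x | forall z, Z z -> (x ^ z) \isin VR'] `&`
  [set x | forall z, [set z^-1 | z in Z] z -> (x ^ z) \isin VR'].
have oO : open O.
  by apply: openI; apply: compact_conjg_open => //; exact: compact_invg.
pose D := [set Q : subgroup G | [/\ open Q, Q `<=` P & P `<=` stabilizer Q]].
have D0 : D !=set0 by exists P; split=> //; exact: stabilizer_self.
have DI (Q Q' : subgroup G) : D Q -> D Q' ->
    exists2 Q'', D Q'' & (Q'' : set G) `<=` (Q : set G) `&` Q'.
  move=> [oQ QP PQ] [oQ' QP' PQ']; exists (setI_subgroup Q Q') => //; split.
  - exact: openI.
  - by move=> x [/QP].
  - exact: stabilizer_setI.
have Dcl (Q : subgroup G) : D Q -> closed (Q : set G).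
  by move=> [oQ _ _]; exact: open_subgroup_closed.
have [Q [oQ QP PQ] VQO] : exists2 Q, D Q & (V : set G) `&` (Q : set G) `<=` O.
  apply: (compact_directed cV D0 DI Dcl oO) => x Vx DQx.
  have Rx : x \isin residual P.
    by split=> [|Q oQ QP PQ]; [exact: VP|exact: DQx].
  split=> z /=; first by move=> /ZP/PR/stabilizerJ h; apply: RVR'; exact: h.
  by move=> [y /ZP/PR/stabilizerJV h <-]; apply: RVR'; exact: h.
have RQ : residual P `<=` Q by move=> x [_]; exact.
pose H := setI_subgroup Q VR'.
have HV h : h \isin H ->
  exists2 y, ((V : set G) `&` (Q : set G)) y & y^-1 * h \isin residual P.
  move=> [Qh [v Vv Rvh]]; exists v => //; split=> //.
  rewrite (_ : v = h * (v^-1 * h)^-1); last by rewrite invgM invgK mulVKg.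
  apply: subgroupM => //; apply: subgroupV; exact: RQ.
exists H, ((V : set G) `&` (Q : set G)); split; split=> //.
- exact: openI.
- by move=> x Rx; split; [exact: RQ|exact: RVR'].
- by move=> x [/QP].
(* Write [h] as [y * r] with [y] in both [V] and [Q] and [r] in the residual: the conjugates of [y]
   are controlled by [O], those of [r] by normality of the residual. *)
- rewrite PZ; apply: generated_min => z Zz; apply: stabilizerP => h Hh.
    split; first by apply: stabilizerJ; [apply: PQ; exact: ZP|case: Hh].
    have [y VQy Ryh] := HV h Hh; rewrite -(mulVKg y h) conjMg.
    apply: (@subgroupM _ VR'); first by apply: (VQO y VQy).1.
    by apply: RVR'; apply: stabilizerJ => //; apply: PR; exact: ZP.
  split; first by apply: stabilizerJV; [apply: PQ; exact: ZP|case: Hh].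
  have [y VQy Ryh] := HV h Hh; rewrite -(mulVKg y h) conjMg.
  apply: (@subgroupM _ VR'); first by apply: (VQO y VQy).2; exists z.
  by apply: RVR'; apply: stabilizerJV => //; apply: PR; exact: ZP.
- by apply: compact_closedI => //; exact: open_subgroup_closed.
- by move=> y [Vy Qy]; split=> //; exact: VVR'.
Qed.

(** * Dense sequences and countable exhaustions *)

Lemma second_countable_dense_sequence (G : topologicalGroupType) :
  @second_countable G -> exists s : nat -> G, forall (x : G) A, nbhs x A ->
    exists n, A (s n).
Proof.
move=> [B /countable_injP[c cI] [oB bB]].
have h n : exists x : G, forall b, B b -> c b = n -> b !=set0 -> b x.
  have [[b [Bb cb [x bx]]]|nb] := pselect (exists b, [/\ B b, c b = n & b !=set0]).
    exists x => b' Bb' cb' _; rewrite (_ : b' = b) //.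
    by apply: cI; rewrite ?inE// cb.
  (* The default value 1 is used when no non-empty basic set has code [n]. *)
  by exists 1 => b Bb cb b0; exfalso; apply: nb; exists b.
exists (fun n => sval (cid (h n))) => x A /bB[b [Bb bx] bA]; exists (c b).
by apply: bA; case: cid => y /= /(_ b Bb erefl); apply; exists x.
Qed.

(** The [n]-th group is generated by a compact open subgroup [U] and the terms of index at most [n]
    of a dense sequence. Every coset [x U] is open, so it contains a term of the sequence. *)
Lemma tdlcsc_exhaustion (G : topologicalGroupType) : tdlcsc G ->
  exists P : nat -> subgroup G, [/\ forall n, open (P n),
    forall n, compactly_generated (P n), forall n, P n `<=` P n.+1 &
    \bigcup_n (P n : set G) = setT].
Proof.
move=> tG; have [_ _ /second_countable_dense_sequence[s sP] _] := tG.
have [U [cU oU _]] := tdlcsc_compact_open tG filterT.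
pose F n := [set s i | i in [set i | (i <= n)%N]].
exists (fun n => generated (U `|` F n)); split=> [n|n|n|].
- apply: subgroup_open; apply: filterS (open_subgroup_nbhs oU) => x Ux.
  by apply: generated_sub; left.
- exists (U `|` F n) => //; apply: compactU => //; apply: finite_compact.
  by apply: finite_image; exact: (finite_II n.+1).
- apply: generated_min => x [Ux|[i /= le_in <-]]; apply: generated_sub;
  [by left|right].
  by exists i => //=; exact: leqW.
- apply/seteqP; split=> // x _.
  have [|n Un] := sP x [set y | y^-1 * x \isin U].
    apply/nbhs1_mull; apply: filterS (open_subgroup_nbhs oU) => y Uy /=.
    by rewrite invgM mulgVK; exact: subgroupV.
  exists n => //; rewrite -(mulVKg (s n) x); apply: subgroupM; apply: generated_sub.
    by right; exists n => /=.
  by left.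
Qed.

(** * The residual description of elementary groups *)

Inductive res_elementary : topologicalGroupType -> Prop :=
| res_elementary_trivial (G : topologicalGroupType) :
    tdlcsc G -> (forall x : G, x = 1) -> res_elementary G
| res_elementary_step (G : topologicalGroupType) :
    tdlcsc G ->
    (forall P : subgroup G, open P -> compactly_generated P ->
      res_elementary (subgroup_group (residual P))) ->
    res_elementary G.

Lemma res_elementary_tdlcsc (G : topologicalGroupType) : res_elementary G ->
  tdlcsc G.
Proof. by case. Qed.

Lemma residual_tdlcsc (G : topologicalGroupType) (P : subgroup G) :
  tdlcsc G -> open P -> tdlcsc (subgroup_group (residual P)).
Proof. by move=> tG oP; apply: subgroup_group_tdlcsc => //;
  exact: residual_closed. Qed.

Lemma compactly_generated_image (G H : topologicalGroupType) (f : G -> H)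
    (P : subgroup G) :
  continuous_morphism f -> tdlcsc H -> compactly_generated P ->
  exists P' : subgroup H, [/\ open P', compactly_generated P' &
    forall x, x \isin P -> f x \isin P'].
Proof.
move=> [cf fM] tH [Z cZ PZ].
have [P' [oP' cP' ZP']] := compactly_generated_open_cover tH (compact_image cf cZ).
exists P'; split=> // x; rewrite PZ.
apply: (generated_min (K := preimage_subgroup fM P')) => z Zz.
by apply: ZP'; exists z.
Qed.

(** The kernel enters through all injective morphisms into [G] killed by [f]. In this form the
    hypothesis passes to the residuals of [G] by composition, and [f] maps each of them into a
    residual of [Q], where the induction hypothesis applies. *)
Lemma res_elementary_morphism (Q : topologicalGroupType) : res_elementary Q ->
  forall (G : topologicalGroupType) (f : G -> Q), tdlcsc G ->
    continuous_morphism f ->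
  (forall (T : topologicalGroupType) (j : T -> G), tdlcsc T ->
    continuous_morphism j ->
    injective j -> (forall t, f (j t) = 1) -> res_elementary T) ->
  res_elementary G.
Proof.
elim=> {}Q tQ h1.
  move=> G f tG fM hker; apply: (hker G id) => //.
  exact: continuous_morphism_id.
move=> IH G f tG fM hker; apply: res_elementary_step => // P oP cP.
have [P' [oP' cP' PP']] := compactly_generated_image fM tQ cP.
have fR (x : subgroup_group (residual P)) : (f \o val) x \isin residual P'.
  by apply: (residual_morphism fM oP PP'); exact: subgroup_group_valP.
have vM := continuous_morphism_val (residual P).
apply: (IH P' oP' cP' _ (corestrict fR)); first exact: residual_tdlcsc.
  by apply: continuous_morphism_corestrict; exact: continuous_morphism_comp.
move=> T j tT jM jI fj1; apply: (hker T (val \o j)) => //.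
- exact: continuous_morphism_comp.
- by apply: inj_comp => //; exact: val_inj.
- by move=> t; have /(congr1 val) := fj1 t; rewrite subgroup_group_val1.
Qed.

Lemma res_elementary_inj (Q G : topologicalGroupType) (f : G -> Q) :
  res_elementary Q -> tdlcsc G -> continuous_morphism f -> injective f ->
  res_elementary G.
Proof.
move=> rQ tG fM fI; apply: (res_elementary_morphism rQ tG fM) => T j tT jM jI fj1.
apply: res_elementary_trivial => // t; apply: (inj_comp fI jI).
by rewrite /= !fj1.
Qed.

Lemma res_elementary_extension (G Q : topologicalGroupType) (f : G -> Q)
    (H : subgroup G) :
  tdlcsc G -> res_elementary Q -> continuous_morphism f ->
  (forall x, f x = 1 -> x \isin H) -> res_elementary (subgroup_group H) ->
  res_elementary G.
Proof.
move=> tG rQ fM fH rH;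
  apply: (res_elementary_morphism rQ tG fM) => T j tT jM jI fj1.
have jH t : j t \isin H by exact: fH.
apply: (res_elementary_inj (f := corestrict jH) rH) => //.
  exact: continuous_morphism_corestrict.
exact: corestrict_inj.
Qed.

(** Every residual of [G] lies in [H]: if [Q] is an open normal subgroup of [G] missing [x], its
    trace on [P] is open and normal in [P] and keeps [x] out of [residual P]. *)
Lemma res_elementary_residually_discrete (G : topologicalGroupType) (H :
  subgroup G) :
  tdlcsc G -> res_elementary (subgroup_group H) ->
  (forall x, ~ x \isin H -> exists Q : subgroup G,
    [/\ open Q, forall g, g \isin stabilizer Q & ~ x \isin Q]) ->
  res_elementary G.
Proof.
move=> tG rH sep; apply: res_elementary_step => // P oP cP.
have RH x : x \isin residual P -> x \isin H.
  move=> [Px hx]; apply: contrapT => /sep[Q [oQ nQ]]; apply.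
  have [] : x \isin setI_subgroup P Q; last by [].
  apply: hx; [exact: openI|by move=> y []|].
  by apply: stabilizer_setI => [|g _]; [exact: stabilizer_self|exact: nQ].
have RH' (x : subgroup_group (residual P)) : val x \isin H.
  by apply: RH; exact: subgroup_group_valP.
apply: (res_elementary_inj (f := corestrict RH') rH).
- exact: residual_tdlcsc.
- by apply: continuous_morphism_corestrict; exact: continuous_morphism_val.
- by apply: corestrict_inj; exact: val_inj.
Qed.

Lemma res_elementary_trivial_subgroup (G : topologicalGroupType) :
  tdlcsc G -> res_elementary (subgroup_group (trivial_subgroup G)).
Proof.
move=> tG; apply: res_elementary_trivial.
  by apply: subgroup_group_tdlcsc => //; exact: tdlcsc_closed1.
move=> x; apply: val_inj; rewrite subgroup_group_val1.
exact: (subgroup_group_valP x).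
Qed.

(** [Q] is the intersection of all conjugates of an open subgroup that misses [x]; it stays open
    because [G] is compact. *)
Lemma compact_residually_discrete (G : topologicalGroupType) (x : G) :
  profinite G -> x <> 1 ->
  exists Q : subgroup G, [/\ open Q, forall g, g \isin stabilizer Q & ~ x \isin Q].
Proof.
move=> [cG hG tdG] x1.
have lcG : locally_compact [set: G].
  by move=> y _; exists setT; [exact: filterT|split=> //; exact: closedT].
have [|U [_ oU Ux]] := compact_open_subgroup_base tdG lcG hG (A := ~` [set x]).
  apply: open_nbhs_nbhs; split=> [|/esym//].
  apply: closed_openC; apply: accessible_closed_set1; exact: hausdorff_accessible.
have core1 : [set y | forall g, [set: G] g -> y ^ g \isin U] 1.
  by move=> g _; rewrite conj1g; exact: subgroup1.
pose Q := @Subgroup _ [set y | forall g, [set: G] g -> y ^ g \isin U] core1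
  (fun x y hx hy g _ => eq_ind_r (fun z => z \isin U)
     (subgroupM (hx g I) (hy g I)) (conjMg x y g))
  (fun x hx g _ => eq_ind_r (fun z => z \isin U)
     (subgroupV (hx g I)) (conjVg x g)).
exists Q; split.
- exact: (compact_conjg_open cG oU).
- by move=> g; apply: stabilizerP => y hy h _ /=; rewrite -conjgM;
  exact: (hy (_ * _) I).
- by move=> /(_ 1 I); rewrite conjg1 => /Ux; apply.
Qed.

(** A compact generating set is covered by the increasing open subgroups, hence by one of them. *)
Lemma compactly_generated_sub_union (G : topologicalGroupType) (P : subgroup G)
    (O : nat -> subgroup G) :
  compactly_generated P -> (forall i, open (O i)) -> (forall i, O i `<=` O i.+1) ->
  P `<=` \bigcup_i (O i : set G) -> exists i, P `<=` O i.
Proof.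
move=> [Z cZ PZ] oO OS PO.
have Omono i j : (i <= j)%N -> O i `<=` O j.
  by move=> /subnK <-; elim: (j - i)%N => // k IH x /IH/OS.
have [i _ hi] : exists2 i, [set: nat] i & Z `&` ~` O i `<=` set0.
  apply: (compact_directed (f := fun i => ~` O i) cZ) => //.
  - move=> i j _ _; exists (maxn i j) => //= x nO; split=> Ox; apply: nO.
      by apply: Omono Ox; exact: leq_maxl.
    by apply: Omono Ox; exact: leq_maxr.
  - by move=> i _; exact: open_closedC.
  - exact: open0.
  - move=> x Zx h; have [|i _ Oi] := PO x; first by rewrite PZ;
    exact: generated_sub.
    exact: (h i I).
exists i; rewrite PZ; apply: generated_min => z Zz; apply: contrapT => nO.
exact: (hi z).
Qed.

(** * Equivalence of the residual description with the class of elementary groups *)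

Lemma elementary_res_elementary (G : topologicalGroupType) :
  elementary G -> res_elementary G.
Proof.
elim=> {}G.
- move=> pG scG; have tG := elementary_tdlcsc (elementary_profinite pG scG).
  apply: res_elementary_residually_discrete (res_elementary_trivial_subgroup
    tG) _ => //.
  by move=> x x1; exact: compact_residually_discrete.
- move=> cG dG; have tG := elementary_tdlcsc (elementary_discrete cG dG).
  apply: res_elementary_residually_discrete (res_elementary_trivial_subgroup
    tG) _ => //.
  move=> x x1; exists (trivial_subgroup G); split=> //.
  by move=> g; apply: stabilizerP => _ ->; rewrite conj1g.
- move=> H tG cH _ rH pdQ.
  (* Profinite and discrete groups are both residually discrete, and the open normal subgroups that
     witness it pull back to [G]. *)
  apply: res_elementary_residually_discrete rH _ => // x nHx.
  have x1 : quotient_map H x <> 1 by move=> /quotient_map1.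
  have [Q [oQ nQ nQx]] : exists Q : subgroup (quotient_group H),
      [/\ open Q, forall g, g \isin stabilizer Q & ~ (quotient_map H x) \isin Q].
    case: pdQ => [pQ|dQ]; first exact: compact_residually_discrete.
    exists (trivial_subgroup _); split=> //.
    by move=> g; apply: stabilizerP => _ ->; rewrite conj1g.
  exists (preimage_subgroup (@quotient_map_multiplicative _ H) Q); split=> //.
  by move=> g; exact: stabilizer_preimage.
- move=> O tG oO OS OT _ rO; apply: res_elementary_step => // P oP cP.
  have [|i PO] := compactly_generated_sub_union cP oO OS; first by rewrite OT.
  have RO (x : subgroup_group (residual P)) : val x \isin O i.
    by apply: PO; apply: residual_sub; exact: subgroup_group_valP.
  apply: (res_elementary_inj (f := corestrict RO) (rO i)).
  + exact: residual_tdlcsc.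
  + by apply: continuous_morphism_corestrict; exact: continuous_morphism_val.
  + by apply: corestrict_inj; exact: val_inj.
Qed.

(** The statement is generalized to groups [T] injecting into [G], because the induction hypothesis
    concerns residuals of [G] while the exhaustion is made in [T]. Each term of the exhaustion is
    built from its residual by a compact quotient followed by a discrete one. *)
Lemma res_elementary_elementary_inj (G : topologicalGroupType) :
  res_elementary G -> forall (T : topologicalGroupType) (j : T -> G), tdlcsc T ->
  continuous_morphism j -> injective j -> elementary T.
Proof.
elim=> {}G tG h1.
  move=> T j tT jM jI; have T1 (x y : T) : x = y by apply: jI;
    rewrite (h1 (j x)) (h1 (j y)).
  apply: elementary_discrete.
    have -> : [set: T] = [set 1] by apply/seteqP; split.
    by apply: finite_set_countable; exact: finite_set1.
  move=> A; have [->|/set0P[x Ax]] := eqVneq A set0; first exact: open0.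
  rewrite (_ : A = setT); first exact: openT.
  by apply/seteqP; split=> // y _; rewrite (T1 y x).
move=> IH T j tT jM jI; have [P [oP cP PS PT]] := tdlcsc_exhaustion tT.
apply: (elementary_union tT oP PS PT) => n.
have [H [Y [[oH RH HP PH] [cY YH YR]]]] := residual_cocompact tT (oP n) (cP n).
have clP : closed (P n) by exact: open_subgroup_closed.
have tS : tdlcsc (subgroup_group (P n)) by exact: subgroup_group_tdlcsc.
(* [NH] is [H] seen in the group type of [P n]; below, [NR] is [residual (P n)] seen in that of
   [NH]. *)
pose NH := normal_of_stabilizer (fun g => stabilizer_preimage
  (@subgroup_group_valM _ (P n)) (PH _ (subgroup_group_valP g))).
have oNH : open NH.
  by apply: preimage_subgroup_open => //; exact: subgroup_val_continuous.
have clNH : closed NH by exact: open_subgroup_closed.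
apply: (elementary_extension tS clNH _ (or_intror (quotient_group_discrete oNH))).
have tNH : tdlcsc (subgroup_group NH) by exact: subgroup_group_tdlcsc.
pose v : subgroup_group NH -> T := val \o val.
have vM : continuous_morphism v.
  by apply: continuous_morphism_comp; exact: continuous_morphism_val.
have vP x : v x \isin P n by exact: subgroup_group_valP.
pose NR := normal_of_stabilizer (fun g => stabilizer_preimage
  vM.2 (stabilizer_residual (oP n) (vP g))).
have clNR : closed NR.
  by apply: preimage_subgroup_closed; [exact: vM.1|exact: residual_closed].
have tNR : tdlcsc (subgroup_group NR) by exact: subgroup_group_tdlcsc.
apply: (elementary_extension (H := NR)) => //; last first.
  left; have [tdQ _ _ hQ] := quotient_group_tdlcsc tNH clNR.
  split=> //; apply: (@quotient_group_compact _ NR (v @^-1` Y)).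
    have cY1 : compact ((val : subgroup_group (P n) -> T) @^-1` Y).
      by apply: subgroup_group_compact => // y /YH/HP.
    by apply: (subgroup_group_compact cY1) => y /YH.
  move=> x; have [y Yy Ryx] := YR (v x) (subgroup_group_valP x).
  have Hy := YH y Yy; pose y1 : subgroup_group (P n) := exist _ y (mem_set (HP
    y Hy)).
  have NHy1 : y1 \isin NH by exact: Hy.
  pose y2 : subgroup_group NH := exist _ y1 (mem_set NHy1).
  by exists y2.
have [P' [oP' cP' PP']] := compactly_generated_image jM tG (cP n).
have jR (x : subgroup_group NR) : j (v (val x)) \isin residual P'.
  by apply: (residual_morphism jM (oP n) PP'); exact: (subgroup_group_valP x).
apply: (IH P' oP' cP' _ (corestrict jR)) => //.
  apply: continuous_morphism_corestrict.
  exact: (continuous_morphism_comp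
    (continuous_morphism_comp (continuous_morphism_val NR) vM) jM).
apply: corestrict_inj => x y /jI xy; do 3 apply: val_inj; exact: xy.
Qed.

Lemma res_elementary_elementary (G : topologicalGroupType) :
  res_elementary G -> elementary G.
Proof.
move=> rG; apply: (res_elementary_elementary_inj rG (j := id)) => //.
  exact: res_elementary_tdlcsc.
exact: continuous_morphism_id.
Qed.

Lemma res_elementary_preimage (G H : topologicalGroupType) (f : G -> H)
    (fM : continuous_morphism f) (K : subgroup H) :
  injective f -> tdlcsc G -> closed K -> res_elementary (subgroup_group K) ->
  res_elementary (subgroup_group (preimage_subgroup fM.2 K)).
Proof.
move=> fI tG cK rK; set K' := preimage_subgroup _ _.
have fK (x : subgroup_group K') : f (val x) \isin K
  by exact: (subgroup_group_valP x).
apply: (res_elementary_inj (f := corestrict fK) rK).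
- by apply: subgroup_group_tdlcsc => //; apply: preimage_subgroup_closed => //;
  exact: fM.1.
- apply: continuous_morphism_corestrict.
  exact: (continuous_morphism_comp (continuous_morphism_val K') fM).
- by apply: corestrict_inj => x y /fI; exact: val_inj.
Qed.

Lemma res_elementary_subgroup (G : topologicalGroupType) (H K : subgroup G) :
  tdlcsc G -> closed H -> H `<=` K -> res_elementary (subgroup_group K) ->
  res_elementary (subgroup_group H).
Proof.
move=> tG cH HK rK.
have HK' (x : subgroup_group H) : val x \isin K by apply: HK;
  exact: subgroup_group_valP.
apply: (res_elementary_inj (f := corestrict HK') rK).
- exact: subgroup_group_tdlcsc.
- by apply: continuous_morphism_corestrict; exact: continuous_morphism_val.
- by apply: corestrict_inj; exact: val_inj.
Qed.

Lemma res_elementary_profinite (G : topologicalGroupType) :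
  tdlcsc G -> compact [set: G] -> res_elementary G.
Proof.
move=> [tdG _ scG hG] cG; apply: elementary_res_elementary.
exact: elementary_profinite.
Qed.

Lemma res_elementary_compact_subgroup (G : topologicalGroupType) (K : subgroup G) :
  tdlcsc G -> compact K -> res_elementary (subgroup_group K).
Proof.
move=> tG cK; have clK : closed K by apply: compact_closed => //; case: tG.
apply: res_elementary_profinite; first exact: subgroup_group_tdlcsc.
have := subgroup_group_compact cK (fun x Kx => Kx).
by congr compact; apply/seteqP; split=> // x _; exact: subgroup_group_valP.
Qed.

(** * Residually elementary groups and increasing unions *)

(* For compactly generated [P] and compact open [V] in [P], compactness gives a
   finite intersection [N] of kernels such that [V `&` N] is normal in [P]. *)
Lemma res_elementary_residually (G : topologicalGroupType) : tdlcsc G ->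
  (forall g : G, g <> 1 -> exists (Q : topologicalGroupType) (f : G -> Q),
    [/\ res_elementary Q, continuous_morphism f & f g <> 1]) ->
  res_elementary G.
Proof.
move=> tG sep; apply: res_elementary_step => // P oP [Z cZ PZ].
have clP : closed P by exact: open_subgroup_closed.
have cclR : closed (residual P) by exact: residual_closed.
apply: (res_elementary_subgroup (K := P) tG cclR); first exact: residual_sub.
have [V [cV oV VP]] := tdlcsc_compact_open tG (open_subgroup_nbhs oP).
have clV : closed V by exact: open_subgroup_closed.
pose O := [set x | forall z, Z z -> x ^ z \isin V] `&`
  [set x | forall z, [set z^-1 | z in Z] z -> x ^ z \isin V].
have oO : open O.
  by apply: openI; apply: compact_conjg_open => //; exact: compact_invg.
(* The last clause says that [G / N] acts like a group of the class: a group mapping to [G] is in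
   the class once the part of it landing in [N] is. Quantifying over all [T] makes [D] stable under
   intersection, by using the property of [N] and then that of [N']. *)
pose D := [set N : subgroup G | [/\ closed N, forall g, g \isin stabilizer N &
  forall (T : topologicalGroupType) (j : T -> G), tdlcsc T ->
    continuous_morphism j ->
    (forall (T' : topologicalGroupType) (j' : T' -> T), tdlcsc T' ->
      continuous_morphism j' -> injective j' -> (forall t, j (j' t) \isin N) ->
      res_elementary T') ->
    res_elementary T]].
have D0 : D !=set0.
  exists (full_subgroup G); split=> [|g|T j tT jM h].
  - exact: closedT.
  - exact: stabilizerP.
  - by apply: (h T id) => //; exact: continuous_morphism_id.
have DI (N N' : subgroup G) : D N -> D N' ->
    exists2 N'', D N'' & (N'' : set G) `<=` (N : set G) `&` N'.
  move=> [cN nN hN] [cN' nN' hN']; exists (setI_subgroup N N') => //; split.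
  - exact: closedI.
  - by move=> g; apply: (@stabilizer_setI _ _ _ (full_subgroup G)) => // x _.
  - move=> T j tT jM h; apply: (hN T j) => // T' j' tT' jM' jI' jN.
    apply: (hN' T' (j \o j')) => //; first exact: continuous_morphism_comp.
    move=> T'' j'' tT'' jM'' jI'' jN'; apply: (h T'' (j' \o j'')) => //.
    + exact: continuous_morphism_comp.
    + exact: inj_comp.
    + by move=> t; split; [exact: jN|exact: jN'].
have Dcl (N : subgroup G) : D N -> closed (N : set G) by case.
(* The kernels of the separating morphisms belong to [D], so the members of [D] have only 1 in
   common, and 1 lies in the open set [O]. *)
have [N [cN nN hN] VNO] : exists2 N, D N & (V : set G) `&` (N : set G) `<=` O.
  apply: (compact_directed cV D0 DI Dcl oO) => x _ DNx.
  suff -> : x = 1 by split=> z _; rewrite conj1g; exact: subgroup1.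
  apply: contrapT => /sep[Q [f [rQ fM fx]]]; have tQ := res_elementary_tdlcsc rQ.
  apply: fx; apply: (DNx (preimage_subgroup fM.2 (trivial_subgroup Q))); split.
  - by apply: preimage_subgroup_closed; [exact: fM.1|exact: tdlcsc_closed1].
  - by move=> g; apply: stabilizer_preimage; apply: stabilizerP => _ ->;
    rewrite conj1g.
  - move=> T j tT jM h;
    apply: (res_elementary_morphism rQ tT (continuous_morphism_comp jM fM)).
    by move=> T' j' tT' jM' jI' jf; exact: (h T' j').
pose M := setI_subgroup N P.
have clM : closed M by exact: closedI.
have tM : tdlcsc (subgroup_group M) by exact: subgroup_group_tdlcsc.
have vM := continuous_morphism_val M.
have rM : res_elementary (subgroup_group M).
  (* The trace of [V] on [M] is compact and open, and it is normal because [P] normalizes the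
     intersection of [V] and [N]. *)
  pose VM := preimage_subgroup vM.2 V.
  apply: (res_elementary_residually_discrete (H := VM)) => //.
    apply: res_elementary_preimage => //.
    exact: res_elementary_compact_subgroup.
  move=> x nVx; exists VM; split=> //.
    by apply: preimage_subgroup_open => //; exact: vM.1.
  suff PVN : P `<=` stabilizer (setI_subgroup V N).
    move=> g; have [Ng Pg] : val g \isin M by exact: subgroup_group_valP.
    have hNx (y : subgroup_group M) : val y \isin N
      by have [] := subgroup_group_valP y.
    apply: stabilizerP => y Vy.
      rewrite -[_ _]/(val (y ^ g) \isin V) (morph_gJ vM.2).
      by have [] := stabilizerJ (PVN _ Pg) (conj Vy (hNx y)).
    rewrite -[_ _]/(val (y ^ g^-1) \isin V) (morph_gJ vM.2) (morph_gV vM.2).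
    by have [] := stabilizerJV (PVN _ Pg) (conj Vy (hNx y)).
  rewrite PZ; apply: generated_min => z Zz; apply: stabilizerP => y VNy.
    by split; [apply: (VNO y VNy).1|apply: stabilizerJ VNy.2].
  by split; [apply: (VNO y VNy).2; exists z|apply: stabilizerJV VNy.2].
apply: (hN (subgroup_group P) val) => //.
- exact: subgroup_group_tdlcsc.
- exact: continuous_morphism_val.
move=> T j tT jM jI jN.
have jNP t : (val \o j) t \isin M by split; [exact: jN|exact: subgroup_group_valP].
apply: (res_elementary_inj (f := corestrict jNP) rM) => //.
- apply: continuous_morphism_corestrict.
  exact: (continuous_morphism_comp jM (continuous_morphism_val P)).
- by apply: corestrict_inj; apply: inj_comp => //; exact: val_inj.
Qed.

Section increasing_union.
Variables (G : topologicalGroupType) (C : nat -> subgroup G).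
Hypotheses (tG : tdlcsc G) (CS : forall i, C i `<=` C i.+1)
  (CG : closure (\bigcup_i (C i : set G)) = setT).

(* When [Y] is biinvariant under the subgroup [V] and contained in [C' * V],
   multiplication by [V] or [Y] on the left is absorbed letter by letter. *)
Inductive coset_words (V Y C' : set G) : G -> Prop :=
| coset_words_base v : V v -> coset_words V Y C' v
| coset_words_mul x w : Y x -> C' x -> coset_words V Y C' w ->
    coset_words V Y C' (x * w).

Lemma increasing_union_cocompact (P V : subgroup G) :
  compactly_generated P -> compact V -> open V -> V `<=` P ->
  exists i, forall x, x \isin P -> exists2 c, c \isin C i & c^-1 * x \isin V.
Proof.
move=> [Z cZ PZ] cV oV VP.
pose Z' := Z `|` [set z^-1 | z in Z].
have cZ' : compact Z' by apply: compactU => //; exact: compact_invg.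
(* [Y] is [V Z' V]: compact, biinvariant under [V], and containing the generators with their
   inverses. *)
pose Y := [set x.1 * x.2 | x in [set x.1 * x.2 | x in (V : set G) `*` Z'] `*`
  (V : set G)].
have cY : compact Y by do 2 apply: compact_mulg => //.
have YV y v : Y y -> v \isin V -> Y (y * v).
  move=> [[a b] [/= ha Vb] <-] Vv; exists (a, b * v); last by rewrite /= mulgA.
  by split=> //; exact: subgroupM.
have VY y v : Y y -> v \isin V -> Y (v * y).
  move=> [[_ b] [/= [[a z] [/= Va Zz] <-] Vb] <-] Vv; exists (v * a * z, b);
    last first.
    by rewrite /= !mulgA.
  by split=> //; exists (v * a, z) => //; split=> //; exact: subgroupM.
have ZY z : Z' z -> Y z.
  move=> Zz; exists (1 * z, 1); last by rewrite /= mul1g mulg1.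
  split; last exact: subgroup1.
  by exists (1, z) => //; split=> //; exact: subgroup1.
have Cmono i j : (i <= j)%N -> C i `<=` C j.
  by move=> /subnK <-; elim: (j - i)%N => // k IH x /IH/CS.
pose CV i := [set x | exists2 c, c \isin C i & c^-1 * x \isin V].
have oCV i : open (CV i).
  rewrite (_ : CV i = \bigcup_(c in (C i : set G)) ((fun x => c^-1 * x) @^-1` V)).
    apply: bigcup_open => c _; apply: open_comp => // y _.
    exact: mulg_continuous_l.
  by apply/seteqP; split=> x [c Cc Vx]; exists c.
(* By density every open coset [y V] meets some [C i], so the increasing open sets [CV i] cover the
   compact set [Y]. *)
have [i _ hi] : exists2 i, [set: nat] i & Y `&` ~` CV i `<=` set0.
  apply: (compact_directed (f := fun i => ~` CV i) cY) => //.
  - move=> i j _ _; exists (maxn i j) => //= x nO; split=> -[c Cc Vx]; apply: nO;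
      exists c => //; apply: Cmono Cc; [exact: leq_maxl|exact: leq_maxr].
  - by move=> i _; exact: open_closedC.
  - exact: open0.
  - move=> y Yy h; have : closure (\bigcup_i (C i : set G)) y by rewrite CG.
    move=> /closureP/(_ V (open_subgroup_nbhs oV))[c [i _ Cc] Vc].
    apply: (h i I); exists c => //.
    by rewrite -(invgK (_ * _)) invgM invgK; exact: subgroupV.
(* The representative [c] can be kept in [Y], since it differs from [y] by an element of [V] on the
   right. *)
have {}hi y : Y y -> exists c, [/\ c \isin C i, Y c & c^-1 * y \isin V].
  move=> Yy; have [c Cc Vc] : CV i y by apply: contrapT => nC; exact: (hi y).
  exists c; split=> //; rewrite -(mulgK (c^-1 * y)^-1 c).
  rewrite -(mulVKg c y) in Yy.
  have : Y (c * (c^-1 * y) * (c^-1 * y)^-1) by apply: YV => //; exact: subgroupV.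
  by rewrite mulgK mulgK.
pose W := coset_words V Y (C i).
have WCV w : W w -> CV i w.
  elim=> [v Vv|x {}w Yx Cx _ [c Cc Vcw]].
    by exists 1; [exact: subgroup1|rewrite invg1 mul1g].
  exists (x * c); first exact: subgroupM.
  by rewrite invgM -mulgA mulKg.
have VW w : W w -> forall v, v \isin V -> W (v * w).
  elim=> [v Vv u Vu|x {}w Yx Cx _ IH v Vv].
    by apply: coset_words_base; exact: subgroupM.
  have [c [Cc Yc Vc]] := hi (v * x) (VY _ _ Yx Vv).
  rewrite mulgA -(mulVKg c (v * x)) -mulgA.
  by apply: coset_words_mul => //; exact: IH.
have YW y w : Y y -> W w -> W (y * w).
  move=> Yy Ww; have [c [Cc Yc Vc]] := hi y Yy.
  by rewrite -(mulVKg c y) -mulgA; apply: coset_words_mul => //; exact: VW.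
exists i => x; rewrite PZ => Zx; apply: WCV.
(* The elements [g] with [g W = W] form a subgroup; it contains the generators because [W] absorbs
   [Y] on the left. Applying its elements to 1 shows that [P] lies in [W]. *)
have S1 : [set g | forall w, W (g * w) <-> W w] 1.
  by move=> w; rewrite mul1g.
have SM g h : [set g | forall w, W (g * w) <-> W w] g ->
    [set g | forall w, W (g * w) <-> W w] h ->
      [set g | forall w, W (g * w) <-> W w] (g * h).
  by move=> hg hh w; rewrite -mulgA hg hh.
have SV g : [set g | forall w, W (g * w) <-> W w] g ->
    [set g | forall w, W (g * w) <-> W w] g^-1.
  by move=> hg w; rewrite -(hg (g^-1 * w)) mulVKg.
have : x \isin Subgroup S1 SM SV.
  apply: Zx => z Zz w; split=> [Wzw|Ww]; last by apply: YW => //; apply: ZY; left.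
  by rewrite -(mulKg z w); apply: YW => //; apply: ZY; right; exists z.
move=> /(_ 1) [_]; rewrite mulg1; apply.
by apply: coset_words_base; exact: subgroup1.
Qed.

(* [C'] is the intersection of open subgroups [U * C'], and each of them has
   finitely many conjugates under [P], because [P] is contained in [C' * V]. *)
Lemma residual_sub_cocompact (C' P V : subgroup G) : closed C' ->
  nbhs (1 : G) (stabilizer C') -> open P -> compact V ->
  (forall x, x \isin P -> exists2 c, c \isin C' & c^-1 * x \isin V) ->
  residual P `<=` C'.
Proof.
move=> cC nC oP cV PCV x [Px hx]; apply: contrapT => nCx.
(* [U] is taken inside the normalizer of [C'], so that [U C'] is a subgroup, and small enough for
   [U C'] to miss [x]. *)
have [U0 [_ oU0 U0x]] := tdlcsc_separated tG cC nCx.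
have [|U [_ oU UU0]] := tdlcsc_compact_open tG (A := (U0 : set G) `&`
  stabilizer C').
  by apply: filterI => //; exact: open_subgroup_nbhs.
have UC : U `<=` stabilizer C' by move=> u /UU0[].
pose O := mul_subgroup UC.
have UO : U `<=` O by move=> u Uu; exists u => //; rewrite mulVg; exact: subgroup1.
have CO : C' `<=` O by move=> c Cc; exists 1;
  [exact: subgroup1|rewrite invg1 mul1g].
have oO : open O by apply: subgroup_open; apply: filterS UO _;
  exact: open_subgroup_nbhs.
have nOx : ~ x \isin O by move=> [u /subgroupV/UU0[/U0x]].
have Q1 : [set y | y \isin P /\ forall g, g \isin P -> y ^ g \isin O] 1.
  by split=> [|g _]; rewrite ?conj1g; exact: subgroup1.
pose Q := @Subgroup _ [set y | y \isin P /\ forall g, g \isin P -> y ^ g \isin O] Q1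
  (fun x y hx hy => conj (subgroupM hx.1 hy.1)
    (fun g Pg => eq_ind_r (fun z => z \isin O)
      (subgroupM (hx.2 g Pg) (hy.2 g Pg)) (conjMg x y g)))
  (fun x hx => conj (subgroupV hx.1)
    (fun g Pg => eq_ind_r (fun z => z \isin O) (subgroupV (hx.2 g Pg)) (conjVg
      x g))).
have QP : Q `<=` P by move=> y [].
have oQ : open Q.
  (* Every [g] in [P] is an element of [V^-1] followed by one of [C'], and conjugation by [C']
     preserves [O]. Only conjugates by the compact set [V^-1] have to be controlled. *)
  have oVO := compact_conjg_open (compact_invg cV) oO.
  have nVO : nbhs (1 : G) [set y | forall z, [set v^-1 | v in (V : set G)] z ->
    y ^ z \isin O].
    by apply: open_nbhs_nbhs; split=> // z _; rewrite conj1g; exact: subgroup1.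
  apply: subgroup_open; apply: filterS (filterI (open_subgroup_nbhs oP) nVO).
  move=> y [Py hy]; split=> // g Pg.
  have [c Cc Vc] := PCV _ (subgroupV Pg).
  have -> : g = (c^-1 * g^-1)^-1 * c^-1 by rewrite invgM !invgK mulgK.
  rewrite conjgM; apply: subgroupJ; last by apply: CO; exact: subgroupV.
  by apply: hy; exists (c^-1 * g^-1).
have [] : x \isin Q; last by move=> _ /(_ 1 (subgroup1 P)); rewrite conjg1.
apply: hx => // g Pg; apply: stabilizerP => y [Py hy].
  split; first exact: subgroupJ.
  by move=> h Ph; rewrite -conjgM; apply: hy; exact: subgroupM.
split; first by apply: subgroupJ => //; exact: subgroupV.
by move=> h Ph; rewrite -conjgM; apply: hy; apply: subgroupM => //;
  exact: subgroupV.
Qed.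

Lemma res_elementary_increasing_union :
  (forall i, closed (C i)) -> (forall i, res_elementary (subgroup_group (C i))) ->
  (forall i, nbhs (1 : G) (stabilizer (C i))) -> res_elementary G.
Proof.
move=> cC rC nC; apply: res_elementary_step => // P oP cP.
have [V [cV oV VP]] := tdlcsc_compact_open tG (open_subgroup_nbhs oP).
have [i hi] := increasing_union_cocompact cP cV oV VP.
apply: (res_elementary_subgroup tG (residual_closed oP) _ (rC i)).
exact: residual_sub_cocompact (cC i) (nC i) oP cV hi.
Qed.
End increasing_union.

(** * Images of normal subgroups *)

(** The complement is the set of [x] with [Y^-1 x] inside the complement of [B], which is open
    because [Y] is compact. *)
Lemma compact_mulg_closed (G : topologicalGroupType) (Y B : set G) :
  compact Y -> closed B -> closed [set x | exists2 y, Y y & B (y^-1 * x)].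
Proof.
move=> cY cB.
have oB : open (~` B) by exact: closed_openC.
have o := compact_mulg_open (compact_invg cY) oB.
rewrite -[X in closed X]setCK; apply: open_closedC.
congr open: o; apply/seteqP; split=> x h.
  by move=> [y Yy]; apply: (h y^-1); exists y.
by move=> _ [y Yy <-] By; apply: h; exists y.
Qed.

(** Subgroups of the centre are normal, so the small open subgroups already separate points from
    1. *)
Lemma res_elementary_open_center (G : topologicalGroupType) : tdlcsc G ->
  nbhs (1 : G) [set x | forall y, x * y = y * x] -> res_elementary G.
Proof.
move=> tG nZ; apply: (res_elementary_residually_discrete (H := trivial_subgroup
  G)) => //.
  exact: res_elementary_trivial_subgroup.
move=> x x1; have [W [_ oW Wx]] := tdlcsc_separated tG (tdlcsc_closed1 tG) x1.
have [|U [_ oU UZ]] := tdlcsc_compact_open tG (A := (W : set G) `&` [set x |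
  forall y, x * y = y * x]).
  by apply: filterI => //; exact: open_subgroup_nbhs.
exists U; split=> //.
  move=> g; have e y h : y \isin U -> y ^ h = y.
    by move=> /UZ[_ Zy]; rewrite /conjg Zy mulKg.
  by apply: stabilizerP => y Uy; rewrite e.
by move=> /subgroupV/UZ[/Wx]; rewrite /= mulVg.
Qed.

Lemma stabilizer_image (G H : groupType) (f : G -> H) (A : set G) (g : G) :
  {morph f : x y / x * y} -> g \isin stabilizer A -> f g \isin stabilizer (f @` A).
Proof.
move=> fM Ag; apply: stabilizerP => _ [x Ax <-].
  by exists (x ^ g); [exact: stabilizerJ|exact: morph_gJ].
exists (x ^ g^-1); first exact: stabilizerJV.
by rewrite (morph_gJ fM) (morph_gV fM).
Qed.

Lemma commute_stabilizer (G : groupType) (g y : G) :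
  y * g = g * y -> y \isin stabilizer [set g].
Proof.
move=> yg; apply: stabilizerP => _ ->.
  by rewrite /= /conjg -yg mulKg.
by rewrite /= /conjg invgK mulgA yg mulgK.
Qed.

Section normal_image.
Variables (K G L : topologicalGroupType) (i : K -> G) (p : G -> L).
Hypotheses (tK : tdlcsc K) (tG : tdlcsc G) (tL : tdlcsc L)
  (iM : continuous_morphism i) (pM : continuous_morphism p) (iI : injective i).
(** Together with continuity and injectivity this says that [i] is a topological embedding. The two
    hypotheses that follow say that its image is normal and that [p] is open at 1, hence
    everywhere. *)
Hypothesis i_embedding : forall A, nbhs (1 : K) A ->
  exists2 B, nbhs (1 : G) B & forall k, B (i k) -> A k.
Hypothesis i_normal : forall k g, exists k', i k' = i k ^ g.
Hypothesis p_open : forall A, nbhs (1 : G) A -> nbhs (1 : L) (p @` A).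

(** The element [z^-1 * k] is the commutator of [z] and [g] pulled back to [K]. It is 1 for [g = 1],
    and compactness of [Z] makes its continuity uniform in [z]. *)
Lemma normal_image_near (Z : set K) (A : set K) : compact Z -> nbhs (1 : K) A ->
  nbhs (1 : G) [set g | forall z, Z z -> forall k, i k = i z ^ g -> A (z^-1 * k)].
Proof.
move=> /compact_near_coveringP cZ /i_embedding[B nB BA].
apply: (cZ G (nbhs (1 : G)) (fun g z => forall k, i k = i z ^ g ->
  A (z^-1 * k))) => z Zz.
have cv : (fun q : K * G => (i q.1)^-1 * i q.1 ^ q.2) @ (z, 1 : G) --> (i z)^-1
  * i z ^ (1 : G).
  have ci : (fun q : K * G => i q.1) @ (z, 1 : G) --> i z.
    by apply: continuous_cvg; [exact: iM.1|exact: cvg_fst].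
  by apply: cvg_mulg; [exact: cvg_invg|apply: cvg_conjg => //; exact: cvg_snd].
rewrite conjg1 mulVg in cv.
have nBz : nbhs (z, 1 : G) [set q : K * G | B ((i q.1)^-1 * i q.1 ^ q.2)]
  by exact: cv.
apply: filterS nBz => -[z' g] /= Bzg k ik; apply: BA.
by rewrite iM.2 (morph_gV iM.2) ik.
Qed.

Let piM : continuous_morphism (p \o i) := continuous_morphism_comp iM pM.

Definition image_closure (P : subgroup K) : subgroup L :=
  closure_subgroup (image_subgroup piM.2 P).

Lemma image_closure_closed (P : subgroup K) : closed (image_closure P).
Proof. exact: closed_closure. Qed.

Lemma image_closure_sub (P Q : subgroup K) :
  P `<=` Q -> image_closure P `<=` image_closure Q.
Proof. by move=> PQ; apply: closureS; exact: image_subset. Qed.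

Lemma image_closure_in (P : subgroup K) k : k \isin P ->
  p (i k) \isin image_closure P.
Proof. by move=> Pk; apply: subset_closure; exists k. Qed.

Lemma image_closure_normal (P Q : subgroup K) :
  P `<=` stabilizer Q -> image_closure P `<=` stabilizer (image_closure Q).
Proof.
move=> PQ; apply: closure_subset_closed; first by apply: stabilizer_closed;
  exact: image_closure_closed.
move=> _ [k Pk <-]; apply: stabilizer_closure.
by apply: (stabilizer_image piM.2); exact: PQ.
Qed.

(** For [g] near 1, both [g] and [g^-1] move each generator [z] within the coset [z P = P], so both
    conjugations map [i P] into itself. *)
Lemma normal_image_stabilizer (P : subgroup K) : open P -> compactly_generated P ->
  nbhs (1 : G) (stabilizer (i @` P)).
Proof.
move=> oP [Z cZ PZ]; have nP := open_subgroup_nbhs oP.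
have ZP : Z `<=` P by rewrite PZ; exact: generated_sub.
have nA := normal_image_near cZ nP.
have nA' : nbhs (1 : G) [set g | forall z, Z z ->
  forall k, i k = i z ^ g^-1 -> z^-1 * k \isin P].
  by move: (nA); rewrite -[X in nbhs X _]invg1 => /invg_continuous.
have h g : (forall z, Z z -> forall k, i k = i z ^ g -> z^-1 * k \isin P) ->
    forall x, (i @` P) x -> (i @` P) (x ^ g).
  move=> hg _ [k Pk <-].
  have jM : {morph (fun k => i k ^ g) : x y / x * y} by move=> x y;
    rewrite iM.2 conjMg.
  suff : P `<=` preimage_subgroup jM (image_subgroup iM.2 P) by apply.
  rewrite {1}PZ; apply: generated_min => z Zz.
  have [k' ik'] := i_normal z g; exists k' => //.
  by rewrite -(mulVKg z k'); apply: subgroupM; [exact: ZP|exact: hg].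
by apply: filterS (filterI nA nA') => g [/h h1 /h h2]; exact: stabilizerP.
Qed.

Lemma image_closure_stabilizer (P : subgroup K) : open P -> compactly_generated P ->
  nbhs (1 : L) (stabilizer (image_closure P)).
Proof.
move=> oP cP; apply: filterS (p_open (normal_image_stabilizer oP cP)) => _ [g
  ig <-].
apply: stabilizer_closure.
by have := stabilizer_image pM.2 ig; rewrite image_comp.
Qed.

(** A cocompact normal [H] of [P] gives a chain [R' <= H' <= C] of closures. [H' / R'] is compact as
    the image of [Y], and [C / H'] has open centre, so two extensions lead from [R'] to [C]. *)
Lemma res_elementary_image_closure_step (P : subgroup K) :
  open P -> compactly_generated P ->
  res_elementary (subgroup_group (image_closure (residual P))) ->
  res_elementary (subgroup_group (image_closure P)).
Proof.
move=> oP cP rR.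
have [H [Y [[oH RH HP PH] [cY YH YR]]]] := residual_cocompact tK oP cP.
set R' := image_closure (residual P) in rR *.
pose H' := image_closure H; set C := image_closure P.
have clR : closed R' by exact: image_closure_closed.
have clH : closed H' by exact: image_closure_closed.
have clC : closed C by exact: image_closure_closed.
have HC : H' `<=` C by exact: image_closure_sub.
have CR : C `<=` stabilizer R'.
  by apply: image_closure_normal; exact: stabilizer_residual.
have CH : C `<=` stabilizer H' by exact: image_closure_normal.
pose Y' := [set p (i y) | y in Y].
have cY' : compact Y' by exact: compact_image piM.1 cY.
have Y'H : Y' `<=` H' by move=> _ [y /YH Hy <-]; exact: image_closure_in.
have H'Y : H' `<=` [set x | exists2 y, Y' y & y^-1 * x \isin R'].
  apply: closure_subset_closed; first exact: compact_mulg_closed.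
  move=> _ [h Hh <-]; have [y Yy Ryh] := YR h Hh; exists (p (i y)); first
    by exists y.
  by have := image_closure_in Ryh;
    rewrite iM.2 pM.2 (morph_gV iM.2) (morph_gV pM.2).
have rH : res_elementary (subgroup_group H').
  have tS : tdlcsc (subgroup_group H') by exact: subgroup_group_tdlcsc.
  have vM := continuous_morphism_val H'.
  pose N := normal_of_stabilizer (fun g : subgroup_group H' =>
    stabilizer_preimage vM.2 (CR _ (HC _ (subgroup_group_valP g)))).
  have clN : closed N by apply: preimage_subgroup_closed clR; exact: vM.1.
  have rN : res_elementary (subgroup_group N).
    by apply: res_elementary_preimage => //; exact: val_inj.
  have rQ : res_elementary (quotient_group N).
    apply: res_elementary_profinite; first exact: quotient_group_tdlcsc.
    apply: (@quotient_group_compact _ N ((val : subgroup_group H' -> L) @^-1` Y')).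
      exact: subgroup_group_compact.
    move=> x; have [y Yy Ryx] := H'Y _ (subgroup_group_valP x).
    pose y1 : subgroup_group H' := exist _ y (mem_set (Y'H y Yy)).
    by exists y1.
  apply: (res_elementary_extension tS rQ (continuous_morphism_quotient N) _ rN).
  by move=> x /quotient_map1.
have tS : tdlcsc (subgroup_group C) by exact: subgroup_group_tdlcsc.
have vM := continuous_morphism_val C.
pose N := normal_of_stabilizer (fun g : subgroup_group C =>
  stabilizer_preimage vM.2 (CH _ (subgroup_group_valP g))).
have clN : closed N by apply: preimage_subgroup_closed clH; exact: vM.1.
have rN : res_elementary (subgroup_group N).
  by apply: res_elementary_preimage => //; exact: val_inj.
have qM := continuous_morphism_quotient N.
have tQ : tdlcsc (quotient_group N) by exact: quotient_group_tdlcsc.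
apply: (res_elementary_extension tS _ qM _ rN); last by move=> x /quotient_map1.
apply: res_elementary_open_center => //.
have [Z cZ PZ] := cP.
have ZP : Z `<=` P by rewrite PZ; exact: generated_sub.
(* For [g] near 1 the commutators of [g] with the generators of [P] lie in [H], so [p g] commutes
   with their images modulo [H']. *)
have nZ := p_open (normal_image_near cZ (open_subgroup_nbhs oH)).
rewrite -(subgroup_group_val1 C) in nZ.
have /(@nbhs_quotient_map _ N) nq : nbhs (1 : subgroup_group C)
    (val @^-1` (p @` [set g | forall z, Z z -> forall k, i k = i z ^ g ->
      z^-1 * k \isin H])).
  exact: vM.1.
rewrite (morph_g1 qM.2) in nq.
apply: filterS nq => _ [c [g Tg gc] <-] y; have [x <-] := quotient_map_surj y.
(* The centralizer of the class of [c] modulo [N] is closed; containing the images of the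
   generators, it contains that of [P], which is dense in [C]. *)
pose Cen := preimage_subgroup qM.2 (stabilizer [set quotient_map N c]).
suff Cx : x \isin Cen by rewrite [LHS]conjgC; congr (_ * _);
  exact: (stabilizerJ Cx erefl).
have clCen : closed Cen.
  apply: preimage_subgroup_closed; first exact: qM.1.
  apply: stabilizer_closed; apply: accessible_closed_set1.
  by apply: hausdorff_accessible; case: tQ.
have PX : P `<=` preimage_subgroup piM.2 (image_subgroup vM.2 Cen).
  rewrite {1}PZ; apply: generated_min => z Zz.
  pose s : subgroup_group C := exist _ (p (i z)) (mem_set (image_closure_in (ZP
    z Zz))).
  exists s => //; apply: commute_stabilizer.
  rewrite -!qM.2; apply/quotient_mapP.
  have [k ik] := i_normal z g; have := image_closure_in (Tg z Zz k ik).
  rewrite iM.2 pM.2 (morph_gV iM.2) (morph_gV pM.2) ik (morph_gJ pM.2) gc =>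
    /subgroupV.
  rewrite -[X in _ -> X]/(val ((s * c)^-1 * (c * s)) \isin H').
  rewrite vM.2 (morph_gV vM.2) !vM.2.
  by rewrite /conjg !invgM !invgK !mulgA.
apply: clCen => B /nbhs_subgroupP[W nW WB].
have /(_ W nW)[_ [[k Pk <-] Wk]] : closure ((p \o i) @` P) (val x).
  exact: (subgroup_group_valP x).
have [s Cs sk] := PX k Pk; exists s; split=> //.
by apply: WB; rewrite /preimage /= sk.
Qed.

(** The closures coming from an exhaustion of [K] are increasing with dense union and have open
    normalizers, so the theorem on increasing unions applies. *)
Lemma res_elementary_image_closure_full :
  (forall P : subgroup K, open P -> compactly_generated P ->
    res_elementary (subgroup_group (image_closure P))) ->
  res_elementary (subgroup_group (image_closure (full_subgroup K))).
Proof.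
move=> rP; set C := image_closure (full_subgroup K).
have [P [oP cP PS PT]] := tdlcsc_exhaustion tK.
have vM := continuous_morphism_val C.
have clC : closed C by exact: image_closure_closed.
have tS : tdlcsc (subgroup_group C) by exact: subgroup_group_tdlcsc.
apply: (@res_elementary_increasing_union _
  (fun n => preimage_subgroup vM.2 (image_closure (P n)))) => //.
- by move=> n x; apply: image_closure_sub.
- apply/seteqP; split=> // x _ B /nbhs_subgroupP[W nW WB].
  have /(_ W nW)[_ [[k _ <-] Wk]] : closure ((p \o i) @` setT) (val x).
    exact: (subgroup_group_valP x).
  have [n _ Pk] : (\bigcup_n (P n : set K)) k by rewrite PT.
  have Ck : p (i k) \isin C by exact: image_closure_in.
  exists (exist _ (p (i k)) (mem_set Ck)); split; last exact: WB.
  by exists n => //; exact: image_closure_in.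
- by move=> n; apply: preimage_subgroup_closed;
  [exact: vM.1|exact: image_closure_closed].
- move=> n; apply: res_elementary_preimage => //; last exact: rP.
  exact: image_closure_closed.
- move=> n; have nS := image_closure_stabilizer (oP n) (cP n).
  rewrite -(subgroup_group_val1 C) in nS.
  have nS' : nbhs (1 : subgroup_group C) (val @^-1` (stabilizer (image_closure
    (P n)))).
    exact: vM.1.
  by apply: filterS nS' => g; exact: stabilizer_preimage.
Qed.

(** Conjugation by [g] pulls back along the embedding [i] to a continuous endomorphism [c] of [K]
    mapping [P] into itself, and such maps preserve the residual. *)
Lemma residual_normal_image (P : subgroup K) (k k' : K) (g : G) : open P ->
  g \isin stabilizer (i @` P) -> k \isin residual P -> i k' = i k ^ g ->
  k' \isin residual P.
Proof.
move=> oP sg Rk ik'.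
have [c cE] : exists c : K -> K, forall x, i (c x) = i x ^ g.
  by exists (fun x => sval (cid (i_normal x g))) => x; case: cid.
have cM : {morph c : x y / x * y}.
  by move=> x y; apply: iI; rewrite iM.2 !cE iM.2 conjMg.
have cc : continuous c.
  move=> x A /nbhs1_mull/i_embedding[B nB BA].
  have cv : (fun y => (i x ^ g)^-1 * i y ^ g) @ x --> (i x ^ g)^-1 * i x ^ g.
    apply: cvg_mulg; first exact: cvg_cst.
    by apply: cvg_conjg; [exact: iM.1|exact: cvg_cst].
  rewrite mulVg in cv.
  have nBx : nbhs x [set y | B ((i x ^ g)^-1 * i y ^ g)] by exact: cv.
  apply: filterS nBx => y /= By.
  have := BA ((c x)^-1 * c y); rewrite iM.2 (morph_gV iM.2) !cE => /(_ By).
  by rewrite /= mulVKg.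
rewrite (_ : k' = c k); last by apply: iI; rewrite ik' cE.
apply: (residual_morphism (conj cc cM) oP) Rk => x Px.
have [y Py iy] : (i @` P) (i x ^ g) by apply: (stabilizerJ sg); exists x.
by rewrite (_ : c x = y) //; apply: iI; rewrite cE.
Qed.
End normal_image.

(** The induction passes from [K] to [residual P], whose image may fail to be normal in [G]. It is
    normal in the open subgroup [M] that normalizes [i P], and restricting [p] to [M] keeps it
    open. *)
Lemma res_elementary_image_closure (K : topologicalGroupType) : res_elementary K ->
  forall (G L : topologicalGroupType) (i : K -> G) (p : G -> L)
    (iM : continuous_morphism i) (pM : continuous_morphism p),
  tdlcsc G -> tdlcsc L -> injective i ->
  (forall A, nbhs (1 : K) A ->
    exists2 B, nbhs (1 : G) B & forall k, B (i k) -> A k) ->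
  (forall k g, exists k', i k' = i k ^ g) ->
  (forall A, nbhs (1 : G) A -> nbhs (1 : L) (p @` A)) ->
  res_elementary (subgroup_group (image_closure iM pM (full_subgroup K))).
Proof.
elim=> {}K tK h1.
  move=> G L i p iM pM tG tL iI i_emb i_nor p_op.
  apply: (@res_elementary_subgroup _ _ (trivial_subgroup L)) => //.
  - exact: image_closure_closed.
  - apply: closure_subset_closed; first exact: tdlcsc_closed1.
    by move=> _ [k _ <-]; rewrite (h1 k) /= (morph_g1 iM.2) (morph_g1 pM.2).
  - exact: res_elementary_trivial_subgroup.
move=> IH G L i p iM pM tG tL iI i_emb i_nor p_op.
apply: res_elementary_image_closure_full => // P oP cP.
apply: res_elementary_image_closure_step => //.
set R := residual P; pose M := stabilizer (i @` P).
have oM : open M by apply: subgroup_open; exact: normal_image_stabilizer.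
have tM : tdlcsc (subgroup_group M).
  by apply: subgroup_group_tdlcsc => //; exact: open_subgroup_closed.
have vM := continuous_morphism_val M.
have vR := continuous_morphism_val R.
have iR (r : subgroup_group R) : (i \o val) r \isin M.
  apply: (@stabilizer_self _ (image_subgroup iM.2 P)); exists (val r) => //.
  by apply: residual_sub; exact: subgroup_group_valP.
have iRM : continuous_morphism (corestrict iR).
  by apply: continuous_morphism_corestrict; exact: continuous_morphism_comp.
have pvM := continuous_morphism_comp vM pM.
apply: (@res_elementary_subgroup _ _ (image_closure iRM pvM (full_subgroup _)))
  => //.
- exact: image_closure_closed.
- apply: closureS => _ [k Rk <-].
  by exists (exist _ k (mem_set Rk)).
apply: IH => //.
- apply: corestrict_inj; apply: inj_comp => //; exact: val_inj.
- move=> A /nbhs_subgroupP[W nW WA]; rewrite (subgroup_group_val1 R) in nW.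
  have [B nB BW] := i_emb W nW; exists (val @^-1` B).
    by apply: vM.1; rewrite subgroup_group_val1.
  by move=> k Bk; apply: WA; exact: BW.
- move=> k g; have [k' ik'] := i_nor (val k) (val g).
  have Rk' : k' \isin R.
    apply: (residual_normal_image iM iI i_emb i_nor oP _ _ ik').
      exact: subgroup_group_valP.
    exact: subgroup_group_valP.
  exists (exist _ k' (mem_set Rk')); apply: val_inj.
  by rewrite (morph_gJ vM.2) !val_corestrict.
- move=> A /nbhs_subgroupP[W nW WA]; rewrite (subgroup_group_val1 M) in nW.
  have nWM : nbhs (1 : G) (W `&` M) by apply: filterI => //;
    exact: open_subgroup_nbhs.
  apply: filterS (p_op _ nWM) => _ [g [Wg Mg] <-].
  by exists (exist _ g (mem_set Mg)) => //; exact: WA.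
Qed.

(** This is the case where [K] is [G], [i] is the identity and [p] is the quotient map, whose image
    is already everything. *)
Lemma res_elementary_quotient (G : topologicalGroupType) (N : normal_subgroup G) :
  res_elementary G -> closed N -> res_elementary (quotient_group N).
Proof.
move=> rG cN; have tG := res_elementary_tdlcsc rG.
have tQ : tdlcsc (quotient_group N) by exact: quotient_group_tdlcsc.
have qM := continuous_morphism_quotient N.
have idM := continuous_morphism_id G.
have rC : res_elementary (subgroup_group (image_closure idM qM (full_subgroup G))).
  apply: res_elementary_image_closure => //.
  - by move=> A nA; exists A.
  - by move=> k g; exists (k ^ g).
  - by move=> A /(@nbhs_quotient_map _ N); rewrite (morph_g1 qM.2).
have Cq (q : quotient_group N) : id q \isin image_closure idM qM (full_subgroup G).
  by have [x <-] := quotient_map_surj q; exact: (image_closure_in idM qM).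
apply: (res_elementary_inj (f := corestrict Cq) rC) => //.
- by apply: continuous_morphism_corestrict; exact: continuous_morphism_id.
- exact: corestrict_inj.
Qed.

(** * Quasi-products *)

Section quasi_product.
Variables (G : topologicalGroupType) (k : nat) (N : 'I_k -> normal_subgroup G).
Hypotheses (tG : tdlcsc G)
  (rN : forall i, res_elementary (subgroup_group (N i))).

(** [M'] is the preimage of the closure [E] of the image of [N i] in [G / M]. That closure is in the
    class, and [M'] is an extension of a group injecting into [E] by [M]. *)
Lemma res_elementary_closed_normal_join (M : normal_subgroup G) (i : 'I_k) :
  closed M -> res_elementary (subgroup_group M) ->
  exists M' : normal_subgroup G, [/\ closed M', res_elementary (subgroup_group M'),
    M `<=` M' & N i `<=` M'].
Proof.
move=> cM rM; have qM := continuous_morphism_quotient M.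
have vN := continuous_morphism_val (N i).
have tQ : tdlcsc (quotient_group M) by exact: quotient_group_tdlcsc.
pose E := image_closure vN qM (full_subgroup _).
have cE : closed E by exact: image_closure_closed.
have rE : res_elementary (subgroup_group E).
  apply: (res_elementary_image_closure (rN i)) => //.
  - move=> A /nbhs_subgroupP[W nW WA]; rewrite (subgroup_group_val1 (N i)) in nW.
    by exists W => // x Wx; exact: WA.
  - move=> x g; have Nx : val x ^ g \isin N i.
      by apply: normal_subgroupJ; exact: subgroup_group_valP.
    by exists (exist _ (val x ^ g) (mem_set Nx)).
  - by move=> A /(@nbhs_quotient_map _ M); rewrite (morph_g1 qM.2).
have nE g : quotient_map M g \isin stabilizer E.
  apply: stabilizer_closure.
  have vNE : [set val x | x in [set: subgroup_group (N i)]] = (N i : set G).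
    apply/seteqP; split=> [_ [x _ <-]|x Nx]; first exact: subgroup_group_valP.
    by exists (exist _ x (mem_set Nx)).
  have -> : (image_subgroup (continuous_morphism_comp vN qM).2 (full_subgroup
    _) : set _) =
      quotient_map M @` (N i : set G).
    transitivity (quotient_map M @` [set val x | x in [set: subgroup_group (N i)]]).
      by rewrite image_comp.
    by rewrite vNE.
  exact: stabilizer_image qM.2 (normal_stabilizer (N i) g).
pose M' := normal_of_stabilizer (fun g => stabilizer_preimage qM.2 (nE g)).
have cM' : closed M' by apply: preimage_subgroup_closed cE; exact: qM.1.
have MM' : M `<=` M'.
  by move=> x /quotient_map1 Mx; rewrite /= /preimage /= Mx;
    exact: (@subgroup1 _ E).
exists M'; split=> //; last first.
  by move=> x Nx; apply: (image_closure_in vN qM (k := exist _ x (mem_set Nx))).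
have tM' : tdlcsc (subgroup_group M') by exact: subgroup_group_tdlcsc.
have vM' := continuous_morphism_val M'.
have ME (x : subgroup_group M') : (quotient_map M \o val) x \isin E.
  exact: (subgroup_group_valP x).
apply: (res_elementary_extension (f := corestrict ME)
  (H := preimage_subgroup vM'.2 M)) => //.
- by apply: continuous_morphism_corestrict; exact: continuous_morphism_comp.
- move=> x /(congr1 val); rewrite val_corestrict subgroup_group_val1.
  by move/quotient_map1.
- by apply: res_elementary_preimage => //; exact: val_inj.
Qed.

(** Joining the factors one at a time gives a closed normal subgroup of the class containing all of
    them; it contains the dense range of the multiplication map, hence is [G]. *)
Lemma res_elementary_quasi_product :
  dense (range (@multiplication_map G k N)) -> res_elementary G.
Proof.
move=> dN.
have join j : (j <= k)%N -> exists M : normal_subgroup G,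
    [/\ closed M, res_elementary (subgroup_group M) &
      forall i : 'I_k, (i < j)%N -> N i `<=` M].
  elim: j => [_|j IH jk].
    have n1 g : g \isin stabilizer (trivial_subgroup G).
      by apply: stabilizerP => _ ->; rewrite /= conj1g.
    exists (normal_of_stabilizer n1); split=> //; first exact: tdlcsc_closed1.
    exact: res_elementary_trivial_subgroup.
  have [M [cM rM NM]] := IH (ltnW jk).
  have [M' [cM' rM' MM' NM']] :=
    res_elementary_closed_normal_join (Ordinal jk) cM rM.
  exists M'; split=> // i; rewrite ltnS leq_eqVlt => /predU1P[ij|/NM Ni].
    by rewrite (_ : i = Ordinal jk) //; exact: val_inj.
  by move=> x /Ni/MM'.
have [M [cM rM NM]] := join k (leqnn k).
have MT x : x \isin M.
  apply: cM => B nB; have [|y [By [u _ uy]]] := dN B° _ (open_interior B).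
    by exists x; exact: nB.
  exists y; split; last exact: interior_subset.
  rewrite -uy /multiplication_map; apply: big_ind => [|y1 y2|i _].
  - exact: subgroup1.
  - exact: subgroupM.
  - by apply: (NM i (ltn_ord i)); exact: subgroup_group_valP.
have Mid x : id x \isin M by exact: MT.
apply: (res_elementary_inj (f := corestrict Mid) rM) => //.
- by apply: continuous_morphism_corestrict; exact: continuous_morphism_id.
- exact: corestrict_inj.
Qed.
End quasi_product.

(** * Countable bases of topological groups *)

Lemma second_countable_group (G : topologicalGroupType) (I J : countType)
    (s : I -> G) (V : J -> subgroup G) :
  (forall j, open (V j)) ->
  (forall A, nbhs (1 : G) A -> exists j, V j `<=` A) ->
  (forall j x, exists i, (s i)^-1 * x \isin V j) ->
  @second_countable G.
Proof.
move=> oV bV sV.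
exists (range (fun ij : I * J => [set x | (s ij.1)^-1 * x \isin V ij.2])).
  by apply: sub_countable (countableP [set: I * J]); exact: card_image_le.
split=> [_ [[i j] _ <-]|x A /nbhs1_mull/bV[j VA]].
  apply: (@open_comp _ _ (fun x => (s i)^-1 * x)); last exact: oV.
  by move=> x _; exact: mulg_continuous_l.
(* The coset [s i * V j] containing [x] is also [x * V j], which lies in [A]. *)
have [i Vi] := sV j x.
exists [set y | (s i)^-1 * y \isin V j]; first by split=> //; exists (i, j).
move=> y Vy; rewrite -(mulVKg x y); apply: VA.
rewrite (_ : x^-1 * y = ((s i)^-1 * x)^-1 * ((s i)^-1 * y)).
  by apply: subgroupM => //; exact: subgroupV.
by rewrite invgM invgK !mulgA mulgK.
Qed.

Lemma tdlcsc_countable_base (G : topologicalGroupType) : tdlcsc G ->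
  exists2 V : nat -> subgroup G, forall n, open (V n) &
    forall A, nbhs (1 : G) A -> exists n, V n `<=` A.
Proof.
move=> tG; have [_ _ [B /countable_injP[c cI] [oB bB]] _] := tG.
have h n : exists V : subgroup G, open V /\
    forall b, B b -> c b = n -> b 1 -> V `<=` b.
  have [[b [Bb cb b1]]|nb] := pselect (exists b, [/\ B b, c b = n & b 1]).
    have [|V [_ oV Vb]] := tdlcsc_compact_open tG (A := b).
      by apply: open_nbhs_nbhs; split=> //; exact: oB.
    exists V; split=> // b' Bb' cb' _; rewrite (_ : b' = b) //.
    by apply: cI; rewrite ?inE// cb.
  exists (full_subgroup G); split; first exact: openT.
  by move=> b Bb cb b1; exfalso; apply: nb; exists b.
exists (fun n => sval (cid (h n))) => [n|A /bB[b [Bb b1] bA]]; first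
  by case: cid => V [].
by exists (c b); case: cid => V /= [_ /(_ b Bb erefl b1) Vb];
  exact: subset_trans bA.
Qed.

(** * Local direct products *)

Section local_direct_product.
Variables (A : Type) (G_ : A -> topologicalGroupType).
Variable U : forall a : A, compact_open_subgroup (G_ a).
Hypotheses (cA : countable [set: A]) (tG : forall a, tdlcsc (G_ a)).

Local Notation L := (local_direct_product U).
Local Notation K := (prod_group (fun a => subgroup_group (U a))).

Definition ldp_proj (a : A) (f : L) : G_ a := (val f : prod_group G_) a.

Lemma ldp_projM a : {morph ldp_proj a : f g / f * g}.
Proof. by move=> f g; rewrite /ldp_proj valM. Qed.

Lemma ldp_val_cvg a : (fun u : K => val (u a)) @ (1 : K) --> (1 : G_ a).
Proof.
move=> W; rewrite -(subgroup_group_val1 (U a)) => nW.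
have nW1 : nbhs (1 : subgroup_group (U a)) (val @^-1` W).
  exact: (subgroup_val_continuous nW).
exact: (@prod_group_proj_continuous _ _ a (1 : K) _ nW1).
Qed.

Lemma ldp_proj_continuous a : continuous (ldp_proj a).
Proof.
move=> f V nV; apply/nbhs_ldpP.
have FK : Filter (nbhs (1 : K)) := nbhs_filter (1 : K).
have c : (fun u : K => ldp_proj a f * val (u a)) @ (1 : K) --> ldp_proj a f * 1.
  apply: cvg_mulg; first exact: cvg_cst.
  exact: ldp_val_cvg.
rewrite mulg1 in c.
have nVc : nbhs (1 : K) [set u | V (ldp_proj a f * val (u a))] by exact: c.
by apply: filterS nVc => u; rewrite /= ldp_projM.
Qed.

Lemma ldp_proj_morphism a : continuous_morphism (ldp_proj a).
Proof. by split; [exact: ldp_proj_continuous|exact: ldp_projM]. Qed.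

Lemma ldp_proj_eq1 (f : L) : (forall a, ldp_proj a f = 1) -> f = 1.
Proof.
by move=> f1; apply/val_inj; apply: functional_extensionality_dep => a; exact: f1.
Qed.

Lemma ldp_proj_neq1 (f : L) : f <> 1 -> exists a, ldp_proj a f <> 1.
Proof.
move=> f1; apply: contrapT => /forallNP h; apply: f1; apply: ldp_proj_eq1 => a.
by have := h a; exact: contrapT.
Qed.

Lemma ldp_incl_range : range (@ldp_incl _ _ U) = [set f | forall a, ldp_proj a
  f \isin U a].
Proof.
apply/seteqP; split=> [_ [u _ <-] a|f Uf]; first exact: (subgroup_group_valP (u a)).
exists (fun a => exist _ (ldp_proj a f) (mem_set (Uf a))) => //.
by apply/val_inj; apply: functional_extensionality_dep.
Qed.

(** The coset criterion is applied with two families indexed by lists: finitely supported functions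
    with values in dense sequences, and subgroups of the product of the [U a] cut down at finitely
    many coordinates. *)
Lemma ldp_second_countable : @second_countable L.
Proof.
have /countable_injP[e eI] := cA.
have {}eI : injective e by move=> a b; apply: eI; rewrite inE.
pose B a := s2val (cid2 (tdlcsc_countable_base (tG a))).
have oB a n : open (B a n) by rewrite /B; case: cid2 => V /= oV _; exact: oV.
have BW a W : nbhs (1 : G_ a) W -> exists n, B a n `<=` W by rewrite /B;
  case: cid2 => V /= _; exact.
have scG a : @second_countable (G_ a) by case: (tG a).
pose D a := sval (cid (second_countable_dense_sequence (scG a))).
have DP a (x : G_ a) W : nbhs x W -> exists n, W (D a n).
  by rewrite /D; case: cid => s /= sP /sP.
have fin_e n : finite_set [set a | (e a < n)%N].
  exact: (@finite_preimage _ _ `I_n e (fun a b _ _ => @eI a b) (finite_II n)).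
(* The coordinate [a] reads the entry of [l] at its code [e a], and is 1 beyond the end of [l]. *)
pose f (l : seq nat) : prod_group G_ := fun a =>
  if (e a < size l)%N then D a (nth 0%N l (e a)) else 1.
have fL l : f l \in (local_direct_product_subgroup U : set _).
  apply/mem_set; apply: sub_finite_set (fin_e (size l)) => a /= nUf.
  apply: contrapT => /negP; rewrite /f in nUf; case: ifP nUf => // _ nU _.
  by apply: nU; exact: subgroup1.
(* A pair [(m, n)] in [l] requires the coordinate with code [m] to lie in the [n]-th basic
   subgroup. *)
pose V_ (l : seq (nat * nat)) : set L := [set g | forall a,
  ldp_proj a g \isin U a /\ forall n, (e a, n) \in l -> ldp_proj a g \isin B a n].
have V1 l : V_ l 1.
  move=> a; rewrite (morph_g1 (@ldp_projM a)).
  by split=> [|n _]; exact: subgroup1.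
have VM l g h : V_ l g -> V_ l h -> V_ l (g * h).
  move=> Vg Vh a; have [Ug Bg] := Vg a; have [Uh Bh] := Vh a; rewrite ldp_projM.
  by split=> [|n ln]; apply: subgroupM => //; [exact: Bg|exact: Bh].
have VV l g : V_ l g -> V_ l g^-1.
  move=> Vg a; have [Ug Bg] := Vg a; rewrite (morph_gV (@ldp_projM a)).
  by split=> [|n ln]; apply: subgroupV => //; exact: Bg.
pose V l := Subgroup (V1 l) (@VM l) (@VV l).
pose C (l : seq (nat * nat)) : set K := [set u | forall a n, (e a, n) \in l ->
  val (u a) \isin B a n].
have FK : Filter (nbhs (1 : K)) := nbhs_filter (1 : K).
have nB a n : nbhs (1 : K) [set u | val (u a) \isin B a n].
  by apply: ldp_val_cvg; exact: open_subgroup_nbhs.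
have nC l : nbhs (1 : K) (C l).
  elim: l => [|[m n] l IH].
    by apply: filterS (@filterT _ _ FK) => u _ a n; rewrite in_nil.
  have nm : nbhs (1 : K) [set u | forall a, e a = m -> val (u a) \isin B a n].
    have [[a0 am]|nm] := pselect (exists a, e a = m).
      by apply: filterS (nB a0 n) => u Bu a; rewrite -am => /eI ->.
    by apply: filterS (@filterT _ _ FK) => u _ a am; exfalso; apply: nm; exists a.
  apply: filterS (filterI nm IH) => u [um ul] a n'.
  by rewrite inE => /predU1P[[/um h ->]|/ul].
apply: (@second_countable_group L (seq nat) (seq (nat * nat))
  (fun l => LocalDirectProduct (fL l)) V).
- move=> l; apply: subgroup_open; apply/nbhs_ldpP.
  apply: filterS (nC l) => u Cu a; rewrite mul1g.
  by split=> [|n /Cu//]; exact: (subgroup_group_valP (u a)).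
- move=> W /nbhs_ldpP nW.
  (* The sets [C l] generate a filter converging to 1 coordinatewise, hence in the product, so some
     [C l] lies in the given neighbourhood. *)
  pose F : set_system K := filter_from setT C.
  have FF : Filter F.
    apply: filter_from_filter; first by exists [::].
    move=> l l' _ _; exists (l ++ l') => // u Cu; split=> a n ln; apply: Cu;
      by rewrite mem_cat ln ?orbT.
  have F1 : F --> (1 : K).
    apply/cvg_prod_group => a Q /nbhs_subgroupP[Q' nQ' QQ'].
    rewrite (subgroup_group_val1 (U a)) in nQ'.
    have [n Bn] := BW a Q' nQ'; exists [:: (e a, n)] => // u Cu /=.
    by apply: QQ'; apply: Bn; apply: Cu; rewrite inE.
  have [l _ CW] := F1 _ nW; exists l => g Vg.
  have [u _ ug] : range (@ldp_incl _ _ U) g by rewrite ldp_incl_range => a;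
    case: (Vg a).
  rewrite -ug -(mul1g (ldp_incl u)); apply: CW => a n /(proj2 (Vg a)).
  by rewrite -ug.
- move=> l x.
  (* [N1] bounds the codes where [x] leaves [U a], and [N2] those constrained by [l]. From their
     maximum on, the value 1 approximates [x] well enough. *)
  have [N1 xN1] : exists N, forall a, ~ ldp_proj a x \isin U a -> (e a < N)%N.
    have /(@finite_seqP {classic A})[t tE] :
      finite_set [set a | ~ ldp_proj a x \isin U a] := set_mem (valP x).
    exists (\max_(a <- t) e a).+1 => a nU; rewrite ltnS.
    apply: (@leq_bigmax_seq {classic A} t xpredT e) => //.
    by have : [set` t] a by rewrite -tE.
  pose N2 := (\max_(q <- l) q.1).+1.
  have lN2 a n : (e a, n) \in l -> (e a < N2)%N.
    by move=> ln; rewrite ltnS;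
      apply: (@leq_bigmax_seq _ l xpredT (fun q => q.1) _ ln).
  have nUl a : nbhs (1 : G_ a) [set y | y \isin U a /\
      forall n, (e a, n) \in l -> y \isin B a n].
    have nUa : nbhs (1 : G_ a) (U a).
      by apply: open_subgroup_nbhs; exact: compact_open_subgroup_open.
    elim: l {lN2 N2} => [|[m n] l IH]; first by apply: filterS nUa.
    apply: filterS (filterI IH (open_subgroup_nbhs (oB a n))) => y [[Uy ly] By].
    by split=> // n'; rewrite inE => /predU1P[[_ ->]|/ly].
  have /choice[c cP] m : exists n, forall a, e a = m ->
      (D a n)^-1 * ldp_proj a x \isin U a /\
      forall n', (e a, n') \in l -> (D a n)^-1 * ldp_proj a x \isin B a n'.
    have [[a am]|nm] := pselect (exists a, e a = m); last first.
      by exists 0%N => a am; exfalso; apply: nm; exists a.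
    have ni : nbhs (1 : G_ a) [set y | y^-1 \isin U a /\
        forall n, (e a, n) \in l -> y^-1 \isin B a n].
      by move: (nUl a); rewrite -[X in nbhs X _]invg1 => /invg_continuous.
    have nx : nbhs (ldp_proj a x) [set y | y^-1 * ldp_proj a x \isin U a /\
        forall n, (e a, n) \in l -> y^-1 * ldp_proj a x \isin B a n].
      apply/nbhs1_mull; apply: filterS ni => y /=.
      by rewrite invgM mulgVK.
    have [n Dn] := DP a _ _ nx; exists n => b; rewrite -am => /eI ->.
    exact: Dn.
  exists (mkseq c (maxn N1 N2)) => a; rewrite ldp_projM (morph_gV (@ldp_projM a)).
  rewrite {1 3}/ldp_proj /= /f size_mkseq; case: ifP => eN.
    by rewrite nth_mkseq //; exact: cP.
  rewrite invg1 mul1g; split=> [|n /lN2 h].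
    by apply: contrapT => /xN1 h; move: eN; rewrite leq_max h.
  by move: eN; rewrite leq_max h orbT.
Qed.

(** The coordinate projections separate points, and the product of the [U a] is open by the choice
    of topology and compact by Tychonoff. *)
Lemma ldp_tdlcsc : tdlcsc L.
Proof.
apply: (@tdlcsc_intro _ (range (@ldp_incl _ _ U))).
- move=> x /ldp_proj_neq1[a xa].
  have [W [_ oW Wx]] := tdlcsc_separated (tG a) (tdlcsc_closed1 (tG a)) xa.
  exists (preimage_subgroup (@ldp_projM a) W).
    by apply: preimage_subgroup_open => //; exact: ldp_proj_continuous.
  by move=> /subgroupV/Wx; apply; rewrite /= mulVg.
- apply: open_nbhs_nbhs; split; first by apply: ldp_incl_open; exact: openT.
  by exists 1 => //; exact: ldp_incl1.
- apply: compact_image; first exact: ldp_incl_continuous.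
  have -> : [set: K] = [set u | forall a, [set: subgroup_group (U a)] (u a)].
    by apply/seteqP; split.
  have cU a : compact [set: subgroup_group (U a)].
    have := subgroup_group_compact (@compact_open_subgroup_compact _ (U a))
      (fun x Ux => Ux).
    by congr compact; apply/seteqP; split=> // x _; exact: subgroup_group_valP.
  exact: (@tychonoff {classic A} (fun a => subgroup_group (U a)) (fun a =>
    setT) cU).
- exact: ldp_second_countable.
Qed.
End local_direct_product.

(** * Permanence properties of the class of elementary groups *)

Theorem theorem1p3 :
  (* (1) *)
  (forall (G : topologicalGroupType) (H : normal_subgroup G),
    tdlcsc G -> closed H ->
    elementary (subgroup_group H) -> elementary (quotient_group H) ->
    elementary G) /\
  (* (2) *)
  ((forall (G H : topologicalGroupType) (psi : {multiplicative H -> G}),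
     elementary G -> tdlcsc H -> continuous psi -> injective psi ->
     elementary H) /\
   (forall (G : topologicalGroupType) (H : subgroup G),
     elementary G -> closed H -> elementary (subgroup_group H))) /\
  (* (3) *)
  (forall (G : topologicalGroupType) (N : normal_subgroup G),
    elementary G -> closed N -> elementary (quotient_group N)) /\
  (* (4) *)
  ((forall G : topologicalGroupType,
     tdlcsc G -> residually_elementary G -> elementary G) /\
   (forall (d : Order.disp_t) (I : preorderType d) (S : inverse_system I),
     directed I -> (forall i : I, elementary (S i)) ->
     tdlcsc (subgroup_group (inverse_limit S)) ->
     elementary (subgroup_group (inverse_limit S)))) /\
  (* (5) *)
  (forall (G : topologicalGroupType) (k : nat) (N : 'I_k -> normal_subgroup G),
    tdlcsc G -> quasi_product N ->
    (forall i : 'I_k, elementary (subgroup_group (N i))) ->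
    elementary G) /\
  (* (6) *)
  (forall (A : Type) (G_ : A -> topologicalGroupType)
      (U : forall a : A, compact_open_subgroup (G_ a)),
    countable [set: A] -> (forall a : A, elementary (G_ a)) ->
    elementary (local_direct_product U)) /\
  (* (7) *)
  (forall (G : topologicalGroupType) (C : nat -> subgroup G),
    tdlcsc G ->
    (forall i : nat, C i `<=` C i.+1) ->
    (forall i : nat, closed (C i)) ->
    (forall i : nat, elementary (subgroup_group (C i))) ->
    (forall i : nat, open (normalizer (C i))) ->
    closure (\bigcup_(i : nat) (C i : set G)) = [set: G] ->
    elementary G).
Proof.
split; [|split; [split|split; [|split; [split|split; [|split]]]]].
- move=> G H tG cH eH eQ; apply: res_elementary_elementary.
  apply: (res_elementary_extension tG (elementary_res_elementary eQ)
    (continuous_morphism_quotient H) _ (elementary_res_elementary eH)) => x.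
  by move/quotient_map1.
- move=> G H psi eG tH cpsi ipsi; apply: res_elementary_elementary.
  apply: (res_elementary_inj (elementary_res_elementary eG) tH _ ipsi).
  by split=> // x y; exact: gmulfM.
- move=> G H eG cH; have rG := elementary_res_elementary eG.
  apply: res_elementary_elementary.
  apply: (res_elementary_inj rG _ (continuous_morphism_val H)); last exact: val_inj.
  by apply: subgroup_group_tdlcsc => //; exact: res_elementary_tdlcsc.
- move=> G N eG cN; apply: res_elementary_elementary.
  by apply: res_elementary_quotient => //; exact: elementary_res_elementary.
- move=> G tG resG; apply: res_elementary_elementary.
  apply: res_elementary_residually => // g /resG[N [cN eN nNg]].
  exists (quotient_group N), (quotient_map N); split.
  + exact: elementary_res_elementary.
  + exact: continuous_morphism_quotient.
  + by move/quotient_map1.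
(* A non-trivial element of an inverse limit has a non-trivial coordinate, so the projections to the
   elementary groups [S i] separate it from 1. *)
- move=> d I S _ eS tS; apply: res_elementary_elementary.
  apply: res_elementary_residually => // g g1.
  have [i gi] : exists i, (val g : prod_group S) i <> 1.
    apply: contrapT => /forallNP h; apply: g1; apply: val_inj.
    apply: functional_extensionality_dep => i.
    by rewrite subgroup_group_val1; exact: contrapT (h i).
  exists (S i), (fun f => (val f : prod_group S) i); split=> //.
    exact: elementary_res_elementary.
  apply: (continuous_morphism_comp (continuous_morphism_val (inverse_limit S))
    (g := fun f : prod_group S => f i)).
  by split; first exact: prod_group_proj_continuous.
- move=> G k N tG [cN _ dN] eN; apply: res_elementary_elementary.
  apply: (res_elementary_quasi_product (N := N)) => // i.
  exact: elementary_res_elementary.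
(* The coordinate projections separate points, so local direct products fall under the residual
   criterion. *)
- move=> A G_ U cA eG; apply: res_elementary_elementary.
  have tG a : tdlcsc (G_ a) by exact: elementary_tdlcsc.
  apply: (res_elementary_residually (ldp_tdlcsc U cA tG)) => f /ldp_proj_neq1[a fa].
  exists (G_ a), (@ldp_proj _ _ U a); split=> //.
    exact: elementary_res_elementary.
  exact: ldp_proj_morphism.
- move=> G C tG CS cC eC oN CG; apply: res_elementary_elementary.
  apply: (res_elementary_increasing_union tG CS CG cC) => i.
    exact: elementary_res_elementary.
  by apply: open_subgroup_nbhs; rewrite stabilizer_normalizer.
Qed.
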